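(* Let $f:\mathbb{R}\to\mathbb{R}$ be smooth, let $$F(t)=\int_0^te^{-\int_0^sf(\sigma)\,d\sigma}\,ds,$$ and let $(u_0,u_1)$ be smooth radial functions on $\mathbb{R}^3$. Consider the equation $$(\ast)\qquad u_{tt}-\Delta u=f(u)(u_t^2-|\nabla u|^2),\quad u(0)=u_0,\quad u_t(0)=u_1.$$ (1) If $F(+\infty)=+\infty$ and $F(-\infty)=-\infty$, then $(\ast)$ admits a corresponding smooth solution $u$ on $\mathbb{R}^{3+1}$. If in addition $u_0\in L^\infty$, then $r(u_0)_r,\ ru_1\in L^\infty$ if and only if $u\in L^\infty_{t,x}$. In this situation, $ru_r,\ ru_t\in L^\infty_{t,x}$ as well. (2) If $F(-\infty)=a\in\mathbb{R}$, suppose that $$-(u_0)_r+|u_1|<\frac{F\circ u_0-a}{r\,F'\circ u_0}=\frac{\int_{-\infty}^{u_0}e^{\int_s^{u_0}f(\sigma)\,d\sigma}\,ds}{r}.\tag{A}$$ If $F(+\infty)=b\in\mathbb{R}$, suppose that $$(u_0)_r+|u_1|<\frac{b-F\circ u_0}{r\,F'\circ u_0}=\frac{\int_{u_0}^{\infty}e^{\int_s^{u_0}f(\sigma)\,d\sigma}\,ds}{r}.\tag{B}$$ (Both are supposed if both $F(-\infty)$ and $F(+\infty)$ are finite.) Then $(\ast)$ admits a corresponding smooth solution $u$ on $\mathbb{R}^{3+1}$ such that $$-u_r+|u_t|<\frac{\int_{-\infty}^{u}e^{\int_s^{u}f(\sigma)\,d\sigma}\,ds}{r}\quad\text{and/or}\quad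 u_r+|u_t|<\frac{\int_u^\infty e^{\int_s^uf(\sigma)\,d\sigma}\,ds}{r}.$$ (3) In the situation of (2), if $u_0\in L^\infty$, then the condition {$r(u_0)_r,\ ru_1\in L^\infty$ and, for some $\epsilon>0$, $$-(u_0)_r+|u_1|\le\frac{\int_{-\infty}^{u_0}e^{\int_s^{u_0}f(\sigma)\,d\sigma}\,ds-\epsilon}{r}\quad\text{and/or}\quad(u_0)_r+|u_1|\le\frac{\int_{u_0}^\infty e^{\int_s^{u_0}f(\sigma)\,d\sigma}\,ds-\epsilon}{r}\}$$ holds if and only if $u\in L^\infty_{t,x}$. In this case, one also has $ru_r,\ ru_t\in L^\infty_{t,x}$ and, for some $\tilde\epsilon>0$ and all $t$, $$-u_r+|u_t|\le\frac{\int_{-\infty}^{u}e^{\int_s^{u}f(\sigma)\,d\sigma}\,ds-\tilde\epsilon}{r}\quad\text{and/or}\quad u_r+|u_t|\le\frac{\int_{u}^\infty e^{\int_s^{u}f(\sigma)\,d\sigma}\,ds-\tilde\epsilon}{r}.$$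
   Context: For a radial function write $u(r)=u(x)$, $|x|=r$; subscript $r$ is the radial derivative; inequalities are for all $r>0$ (and all $t$). $F$ is strictly increasing, $F(\pm\infty)$ denote its limits at $\pm\infty$ (finite or infinite). In each ''and/or'', the first inequality (lower integration limit $-\infty$) is meant when $F(-\infty)$ is finite, the second (upper limit $+\infty$) when $F(+\infty)$ is finite, and both when both are finite. $L^\infty_{t,x}$ means bounded on $\mathbb{R}^{3+1}$. *)

(* Defs.v *)
From Stdlib Require Import Reals.
From Coquelicot Require Import Coquelicot.

Open Scope R_scope.

(* Derivative of g along v; for v a coordinate vector this is a partial
   derivative. *)
Definition Ddir {V : NormedModule R_AbsRing} (v : V) (g : V -> R) (x : V) : R :=
  Derive (fun h => g (plus x (scal h v))) 0.

Definition ex_Ddir {V : NormedModule R_AbsRing} (v : V) (g : V -> R) (x : V) : Prop :=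
  ex_derive (fun h => g (plus x (scal h v))) 0.

(* On a finite-dimensional space (the only use below), iterated directional
   derivatives existing and being continuous up to order n is the usual C^n. *)
Fixpoint Ck {V : NormedModule R_AbsRing} (n : nat) (g : V -> R) : Prop :=
  (forall x, continuous g x) /\
  match n with
  | O => True
  | S m => forall v, (forall x, ex_Ddir v g x) /\ Ck m (Ddir v g)
  end.

Definition smooth {V : NormedModule R_AbsRing} (g : V -> R) : Prop :=
  forall n, Ck n g.

Definition R3 : NormedModule R_AbsRing :=
  prod_NormedModule R_AbsRing
    (prod_NormedModule R_AbsRing R_NormedModule R_NormedModule) R_NormedModule.

Definition R4 : NormedModule R_AbsRing :=
  prod_NormedModule R_AbsRing R_NormedModule R3.

(* Not Coquelicot's norm on the product, although it induces the same topology. *)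
Definition enorm (p : R3) : R :=
  let '(x, y, z) := p in sqrt (x ^ 2 + y ^ 2 + z ^ 2).

Definition radial (g : R3 -> R) : Prop :=
  forall p q : R3, enorm p = enorm q -> g p = g q.

(* For radial g and r >= 0 this is g(r), the value of g on the sphere of
   radius r; its derivative at r > 0 is the radial derivative g_r. *)
Definition profile (g : R3 -> R) (r : R) : R := g ((r, 0), 0).

Definition dr (g : R3 -> R) (r : R) : R := Derive (profile g) r.

Definition dt (u : R -> R3 -> R) (t : R) (p : R3) : R := Derive (fun s => u s p) t.

Definition laplacian (g : R3 -> R) (p : R3) : R :=
  let '(x, y, z) := p in
  Derive_n (fun s => g ((s, y), z)) 2 x +
  Derive_n (fun s => g ((x, s), z)) 2 y +
  Derive_n (fun s => g ((x, y), s)) 2 z.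

Definition grad_sq (g : R3 -> R) (p : R3) : R :=
  let '(x, y, z) := p in
  Derive (fun s => g ((s, y), z)) x ^ 2 +
  Derive (fun s => g ((x, s), z)) y ^ 2 +
  Derive (fun s => g ((x, y), s)) z ^ 2.

Definition smooth_solution (f : R -> R) (u0 u1 : R3 -> R) (u : R -> R3 -> R) : Prop :=
  smooth (fun q : R4 => u (fst q) (snd q)) /\
  (forall t p,
     Derive_n (fun s => u s p) 2 t - laplacian (u t) p =
     f (u t p) * (dt u t p ^ 2 - grad_sq (u t) p)) /\
  (forall p, u 0 p = u0 p) /\
  (forall p, dt u 0 p = u1 p).

Definition F (f : R -> R) (t : R) : R :=
  RInt (fun s => exp (- RInt f 0 s)) 0 t.

(* The integrals of exp (int_s^w f) over s < w and over s > w. RInt_gen is a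
   total function: it is meaningful when F has a finite limit at -oo,
   resp. +oo. *)
Definition lower_int (f : R -> R) (w : R) : R :=
  RInt_gen (fun s => exp (RInt f s w)) (Rbar_locally m_infty) (at_point w).

Definition upper_int (f : R -> R) (w : R) : R :=
  RInt_gen (fun s => exp (RInt f s w)) (at_point w) (Rbar_locally p_infty).

Definition bounded_x (g : R3 -> R) : Prop :=
  exists M, forall p, Rabs (g p) <= M.

Definition bounded_tx (u : R -> R3 -> R) : Prop :=
  exists M, forall t p, Rabs (u t p) <= M.

(* Boundedness of functions of r = |x| > 0, resp. of (t, r). *)
Definition bounded_r (h : R -> R) : Prop :=
  exists M, forall r, 0 < r -> Rabs (h r) <= M.

Definition bounded_tr (h : R -> R -> R) : Prop :=
  exists M, forall t r, 0 < r -> Rabs (h t r) <= M.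

(* Main.v *)
Require Import Defs.
From Stdlib Require Import Reals Lra Lia Classical IndefiniteDescription.
From Coquelicot Require Import Coquelicot.

Open Scope R_scope.

(** The equation is a linear wave equation in disguise: since F'' = - f F', the
    function v = F(u) satisfies v_tt - Lap v = 0 exactly when u satisfies the
    nonlinear equation. As F increases strictly, u can be recovered from v as
    long as v stays in the range of F, so everything reduces to the range of a
    radial solution of the linear equation in dimension 3.

    For such a solution, r v solves the wave equation on the line, which gives
    v(t, r) as the average over [t - r, t + r] of the single function
    g(s) = v0(s) + s v0'(s) + s v1(s) of the initial data [transport]. Two
    consequences carry the whole statement. First, v(s, 0) = g(s), and every
    value of an average of g is a value of g, so v and g have the same range
    [solution_center, solution_attained]. Second, v + r v_r + r v_t = g(t + r)
    and v + r v_r - r v_t = g(t - r); written in terms of u these are the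
    relations [characteristic], and they turn each displayed inequality on
    - u_r + |u_t| or u_r + |u_t| at a point into an inequality on g(t + r) and
    g(t - r), namely that they lie above F(-oo) or below F(+oo), by a definite
    amount in the uniform versions [lower_strict, lower_quantitative and their
    mirror images]. Hence the hypotheses on the data say that g takes its values
    in the range of F, or in a compact part of it, and the same is then read off
    at every time. When both limits of F are infinite, those hypotheses are
    vacuous, so the first case of the theorem is an instance of the others.

    The smoothness of u at the spatial origin, where the radius |x| is not
    smooth, is obtained from the representation of v by the integral of
    g(t + |x| th) over -1 <= th <= 1. Differentiating such integrals in x and
    integrating by parts yields x times an integral of the same kind, with the
    weight multiplied by 1 - th^2 and g replaced by g'' [wave_is_Ddir]; no
    division by |x| ever appears. Smoothness then passes from v to u because
    each derivative of u is one of v times a smooth function of u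
    [inverse_Ck]. *)

(** * Smooth functions of one variable *)

Definition Cinf (g : R -> R) : Prop := forall n x, ex_derive_n g n x.

Lemma is_derive_eq (g : R -> R) (x l l' : R) : is_derive g x l -> l = l' -> is_derive g x l'.
Proof. now intros H <-. Qed.

Lemma is_derive_mult_const (g : R -> R) (x l w : R) :
  is_derive g x l -> is_derive (fun z => g z * w) x (l * w).
Proof. intros H. exact (is_derive_scal_l g x l w H). Qed.

Lemma Cinf_Derive g : Cinf g -> Cinf (Derive g).
Proof.
intros Hg [|n] x; [exact I|].
apply (ex_derive_ext (Derive_n g (S n))).
- intros s. replace (S n) with (n + 1)%nat by lia. now rewrite <- Derive_n_comp.
- exact (Hg (S (S n)) x).
Qed.

Lemma Cinf_is_derive g x : Cinf g -> is_derive g x (Derive g x).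
Proof. intros Hg. apply Derive_correct. exact (Hg 1%nat x). Qed.

Lemma Cinf_continuous g x : Cinf g -> continuous g x.
Proof. intros Hg. apply (ex_derive_continuous g). exact (Hg 1%nat x). Qed.

Lemma Cinf_antiderivative g h :
  Cinf h -> (forall x, is_derive g x (h x)) -> Cinf g.
Proof.
intros Hh Hg [|n] x; [exact I|].
destruct n as [|n]; [exists (h x); apply Hg|].
apply (ex_derive_ext (Derive_n h n)); [|exact (Hh (S n) x)].
intros s. replace (S n) with (n + 1)%nat by lia. rewrite <- Derive_n_comp.
apply Derive_n_ext. intros y. symmetry. apply is_derive_unique, Hg.
Qed.

Lemma Cinf_exp : Cinf exp.
Proof.
intros [|n] x; [exact I|].
apply (ex_derive_ext exp).
- intros s. symmetry. apply is_derive_n_unique, is_derive_n_exp.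
- exists (exp x). apply is_derive_exp.
Qed.

(** * Weighted means over intervals *)

Definition weight (k : nat) (th : R) : R := (1 - th ^ 2) ^ k.

(** Up to the factor 2, [mean 0 g t |x|] is the average over unit vectors om of
    the plane waves g(t + om.x), because om.x is uniformly distributed on
    [-|x|, |x|] in dimension 3. The weights [1 - th^2] come from the spatial
    derivatives. *)
Definition mean (k : nat) (g : R -> R) (t r : R) : R :=
  RInt (fun th => g (t + r * th) * weight k th) (-1) 1.

Lemma weight_derive k th :
  is_derive (weight (S k)) th (- (2 * INR (S k)) * (th * weight k th)).
Proof.
unfold weight. auto_derive; [easy|].
change (match k with 0%nat => 1 | S _ => INR k + 1 end) with (INR (S k)).
replace (1 + - (th * (th * 1))) with (1 - th ^ 2) by ring. ring.
Qed.

Lemma weight_continuous k th : continuous (weight k) th.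
Proof.
apply (ex_derive_continuous (weight k)). unfold weight. auto_derive. easy.
Qed.

Lemma weight_bound k th : -1 <= th <= 1 -> Rabs (weight k th) <= 1.
Proof.
intros Hth. unfold weight. rewrite <- RPow_abs.
apply Rle_trans with (1 ^ k); [|rewrite pow1; lra]. apply pow_incr. split; [apply Rabs_pos|].
assert (0 <= th * th <= 1) by nra. apply Rabs_le. simpl. lra.
Qed.

Lemma affine_continuous g t r th :
  Cinf g -> continuous (fun th => g (t + r * th)) th.
Proof.
intros Hg. apply (continuous_comp (fun th => t + r * th) g).
- apply (ex_derive_continuous (fun th => t + r * th)). auto_derive. easy.
- now apply Cinf_continuous.
Qed.

Lemma mean_integrand_continuous k g t r th :
  Cinf g -> continuous (fun th => g (t + r * th) * weight k th) th.
Proof.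
intros Hg. apply (continuous_mult (fun th => g (t + r * th)) (weight k)).
- now apply affine_continuous.
- apply weight_continuous.
Qed.

Lemma ex_mean k g t r a b : Cinf g ->
  ex_RInt (fun th => g (t + r * th) * weight k th) a b.
Proof.
intros Hg. apply (@ex_RInt_continuous R_CompleteNormedModule).
intros z _. now apply mean_integrand_continuous.
Qed.

Lemma ex_RInt_cont (h : R -> R) a b : (forall x, continuous h x) -> ex_RInt h a b.
Proof. intros Hh. apply (@ex_RInt_continuous R_CompleteNormedModule). intros; apply Hh. Qed.

Lemma RInt_linear (c d : R) (h k : R -> R) a b :
  (forall x, continuous h x) -> (forall x, continuous k x) ->
  RInt (fun x => c * h x + d * k x) a b = c * RInt h a b + d * RInt k a b.
Proof.
intros Hh Hk.
transitivity (RInt (fun x => c * h x) a b + RInt (fun x => d * k x) a b).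
- apply (RInt_plus (fun x => c * h x) (fun x => d * k x)); apply ex_RInt_cont; intros x.
  + apply (continuous_scal_r c h), Hh.
  + apply (continuous_scal_r d k), Hk.
- f_equal; [apply (RInt_scal h)|apply (RInt_scal k)]; now apply ex_RInt_cont.
Qed.

Lemma RInt_reflect (h : R -> R) : (forall x, continuous h x) ->
  RInt (fun x => h (- x)) (-1) 1 = RInt h (-1) 1.
Proof.
intros Hh. apply is_RInt_unique.
assert (H : is_RInt h 1 (-1) (- RInt h (-1) 1)).
{ apply (is_RInt_swap h). apply (@RInt_correct R_CompleteNormedModule).
  apply (@ex_RInt_continuous R_CompleteNormedModule). intros; apply Hh. }
replace 1 with (- -1) in H at 1 by ring.
apply is_RInt_comp_opp in H.
apply is_RInt_opp in H. simpl in H.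
unfold opp in H; simpl in H. rewrite Ropp_involutive in H.
eapply is_RInt_ext; [|exact H]. intros; simpl. apply Ropp_involutive.
Qed.

Lemma RInt_odd (h : R -> R) : (forall x, continuous h x) -> (forall x, h (- x) = - h x) ->
  RInt h (-1) 1 = 0.
Proof.
intros Hc Ho. pose proof (RInt_reflect h Hc) as E.
rewrite (@RInt_ext R_CompleteNormedModule (fun x => h (- x)) (fun x => opp (h x))) in E by (intros; apply Ho).
rewrite (@RInt_opp R_CompleteNormedModule) in E.
- unfold opp in E; simpl in E. lra.
- apply (@ex_RInt_continuous R_CompleteNormedModule). intros; apply Hc.
Qed.

Lemma mean_even k g t r : Cinf g -> mean k g t (- r) = mean k g t r.
Proof.
intros Hg. unfold mean.
rewrite <- (RInt_reflect (fun th => g (t + r * th) * weight k th)).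
- apply RInt_ext. intros x _. unfold weight.
  f_equal; [f_equal; ring|f_equal; ring].
- intros x. now apply mean_integrand_continuous.
Qed.

(** The fundamental theorem of calculus for h(t + r th) p(th). It is applied
    with functions p that vanish at both ends for the derivatives in space, and
    with p = 1 or p = th to produce the values of h at the ends. *)
Lemma segment_by_parts h (p p' : R -> R) t r : Cinf h ->
  (forall x, is_derive p x (p' x)) -> (forall x, continuous p' x) ->
  r * RInt (fun th => Derive h (t + r * th) * p th) (-1) 1
  + RInt (fun th => h (t + r * th) * p' th) (-1) 1
  = h (t + r) * p 1 - h (t - r) * p (-1).
Proof.
intros Hh Hp Hp'.
assert (Hpc : forall x, continuous p x).
{ intros x. apply (ex_derive_continuous p). eexists; apply Hp. }
set (A := fun th => Derive h (t + r * th) * p th).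
set (B := fun th => h (t + r * th) * p' th).
assert (HA : forall th, continuous A th).
{ intros th. apply (continuous_mult (fun th => Derive h (t + r * th)) p); [|apply Hpc].
  now apply affine_continuous, Cinf_Derive. }
assert (HB : forall th, continuous B th).
{ intros th. apply (continuous_mult (fun th => h (t + r * th)) p'); [|apply Hp'].
  now apply affine_continuous. }
assert (HI : is_RInt (fun th => r * A th + B th) (-1) 1
               (h (t + r) * p 1 - h (t - r) * p (-1))).
{ set (C := fun th => h (t + r * th) * p th).
  replace (_ - _) with (minus (C 1) (C (-1))).
  - apply (is_RInt_derive C).
    + intros th _.
      apply (is_derive_eq _ _ ((r * Derive h (t + r * th)) * p th + h (t + r * th) * p' th)).
      * apply (is_derive_mult (fun th => h (t + r * th)) p); [|apply Hp|intros; apply Rmult_comm].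
        apply (is_derive_comp h (fun th => t + r * th)); [now apply Cinf_is_derive|].
        auto_derive; [easy|ring].
      * unfold A, B. ring.
    + intros th _. apply (continuous_plus (fun th => r * A th) B); auto.
      apply (continuous_scal_r r A); auto.
  - unfold C, minus, plus, opp; simpl.
    replace (t + r * 1) with (t + r) by ring.
    replace (t + r * -1) with (t - r) by ring. ring. }
rewrite <- (is_RInt_unique _ _ _ _ HI). symmetry.
rewrite (RInt_ext _ (fun th => r * A th + 1 * B th)) by (intros; simpl; ring).
rewrite RInt_linear by trivial. fold A B. ring.
Qed.

(** The factor r gained here makes the radial derivative of a mean divisible by
    r, which is what keeps the Cartesian derivatives regular at the origin. *)
Lemma mean_by_parts k g t r : Cinf g ->
  RInt (fun th => g (t + r * th) * (th * weight k th)) (-1) 1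
  = r / (2 * INR (S k)) * mean (S k) (Derive g) t r.
Proof.
intros Hg.
pose proof (segment_by_parts g (weight (S k)) (fun th => - (2 * INR (S k)) * (th * weight k th)) t r Hg
  (weight_derive k)) as H.
assert (Hw : forall x, continuous (fun th => th * weight k th) x).
{ intros x. apply (continuous_mult (fun th => th) (weight k)).
  - apply continuous_id. - apply weight_continuous. }
lapply H; clear H; [intros H|].
2: { intros x. apply (continuous_scal_r (- (2 * INR (S k))) (fun th => th * weight k th)). apply Hw. }
fold (mean (S k) (Derive g) t r) in H.
replace (RInt (fun th => g (t + r * th) * (- (2 * INR (S k)) * (th * weight k th))) (-1) 1)
  with (- (2 * INR (S k)) * RInt (fun th => g (t + r * th) * (th * weight k th)) (-1) 1) in H.
2: { symmetry. transitivity (RInt (fun th => scal (- (2 * INR (S k))) (g (t + r * th) * (th * weight k th))) (-1) 1).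
  - apply RInt_ext. intros x _. unfold scal; simpl. unfold mult; simpl. ring.
  - apply (RInt_scal (fun th => g (t + r * th) * (th * weight k th))).
    apply (@ex_RInt_continuous R_CompleteNormedModule). intros z _.
    apply (continuous_mult (fun th => g (t + r * th)) (fun th => th * weight k th)); [|apply Hw].
    now apply affine_continuous. }
assert (0 < INR (S k)) by (apply lt_0_INR; lia).
assert (H1 : weight (S k) 1 = 0) by (unfold weight; simpl; ring).
assert (H2 : weight (S k) (-1) = 0) by (unfold weight; simpl; ring).
rewrite H1, H2 in H.
apply (Rmult_eq_reg_l (2 * INR (S k))); [|lra].
replace (2 * INR (S k) * (r / (2 * INR (S k)) * mean (S k) (Derive g) t r))
  with (r * mean (S k) (Derive g) t r) by (field; lra).
lra.
Qed.

Lemma continuity_2d_affine g w t r s :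
  (forall x, continuous g x) -> continuous w s ->
  continuity_2d_pt (fun u v => g (u + r * v) * w v) t s /\
  continuity_2d_pt (fun u v => g (t + u * v) * w v) r s.
Proof.
intros Hg Hw.
assert (Hw2 : forall x, continuity_2d_pt (fun _ v => w v) x s).
{ intros x. apply (continuity_1d_2d_pt_comp w (fun _ v => v)).
  - now apply continuity_pt_filterlim.
  - apply continuity_2d_pt_id2. }
split; apply continuity_2d_pt_mult; auto.
- apply (continuity_1d_2d_pt_comp g (fun u v => u + r * v)).
  + apply continuity_pt_filterlim, Hg.
  + apply continuity_2d_pt_plus; [apply continuity_2d_pt_id1|].
    apply continuity_2d_pt_mult; [apply continuity_2d_pt_const|apply continuity_2d_pt_id2].
- apply (continuity_1d_2d_pt_comp g (fun u v => t + u * v)).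
  + apply continuity_pt_filterlim, Hg.
  + apply continuity_2d_pt_plus; [apply continuity_2d_pt_const|].
    apply continuity_2d_pt_mult; [apply continuity_2d_pt_id1|apply continuity_2d_pt_id2].
Qed.

Lemma mean_dt k g t r : Cinf g ->
  is_derive (fun t => mean k g t r) t (mean k (Derive g) t r).
Proof.
intros Hg.
assert (HD : forall u th, is_derive (fun z => g (z + r * th) * weight k th) u
              (Derive g (u + r * th) * weight k th)).
{ intros u th. apply is_derive_mult_const.
  apply (is_derive_eq _ _ (1 * Derive g (u + r * th))); [|ring].
  apply (is_derive_comp g (fun z => z + r * th)); [now apply Cinf_is_derive|].
  auto_derive; [easy|ring]. }
unfold mean.
rewrite (@RInt_ext R_CompleteNormedModule _ (fun th => Derive (fun z => g (z + r * th) * weight k th) t))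
  by (intros; symmetry; apply is_derive_unique, HD).
apply (is_derive_RInt_param (fun z th => g (z + r * th) * weight k th)).
- apply filter_forall. intros u th _. eexists. apply HD.
- intros th _.
  apply (continuity_2d_pt_ext (fun u v => Derive g (u + r * v) * weight k v)).
  + intros u v. symmetry. apply is_derive_unique, HD.
  + apply (continuity_2d_affine (Derive g)); [|apply weight_continuous].
    intros; now apply Cinf_continuous, Cinf_Derive.
- apply filter_forall. intros; now apply ex_mean.
Qed.

Lemma mean_dr_raw k g t r : Cinf g ->
  is_derive (fun r => mean k g t r) r
    (RInt (fun th => Derive g (t + r * th) * (th * weight k th)) (-1) 1).
Proof.
intros Hg.
assert (HD : forall u th, is_derive (fun z => g (t + z * th) * weight k th) u
              (Derive g (t + u * th) * (th * weight k th))).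
{ intros u th.
  apply (is_derive_eq _ _ (th * Derive g (t + u * th) * weight k th)); [|ring].
  apply is_derive_mult_const.
  apply (is_derive_comp g (fun z => t + z * th)); [now apply Cinf_is_derive|].
  auto_derive; [easy|ring]. }
unfold mean.
rewrite (@RInt_ext R_CompleteNormedModule _ (fun th => Derive (fun z => g (t + z * th) * weight k th) r))
  by (intros; symmetry; apply is_derive_unique, HD).
apply (is_derive_RInt_param (fun z th => g (t + z * th) * weight k th)).
- apply filter_forall. intros u th _. eexists. apply HD.
- intros th _.
  apply (continuity_2d_pt_ext (fun u v => Derive g (t + u * v) * (v * weight k v))).
  + intros u v. symmetry. apply is_derive_unique, HD.
  + apply (continuity_2d_affine (Derive g) (fun v => v * weight k v) t r).
    * intros; now apply Cinf_continuous, Cinf_Derive.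
    * apply (continuous_mult (fun th => th) (weight k)).
      -- apply continuous_id. -- apply weight_continuous.
- apply filter_forall. intros; now apply ex_mean.
Qed.

Lemma mean_dr k g t r : Cinf g ->
  is_derive (fun r => mean k g t r) r
    (r / (2 * INR (S k)) * mean (S k) (Derive (Derive g)) t r).
Proof.
intros Hg. rewrite <- mean_by_parts by now apply Cinf_Derive.
now apply mean_dr_raw.
Qed.

Lemma bounded_on_segment g B : (forall x, continuous g x) ->
  exists K, 0 < K /\ forall x, -B <= x <= B -> Rabs (g x) <= K.
Proof.
intros Hg. destruct (Rle_dec (-B) B) as [HB|HB].
2: { exists 1. split; [lra|]. intros; lra. }
destruct (continuity_ab_maj (fun x => Rabs (g x)) (-B) B HB) as [M [HM _]].
{ intros c _. apply continuity_pt_filterlim.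
  apply (continuous_comp g Rabs); [apply Hg|apply continuous_Rabs]. }
exists (Rabs (g M) + 1). split; [pose proof (Rabs_pos (g M)); lra|].
intros x Hx. specialize (HM x Hx). simpl in HM. lra.
Qed.

(** Joint continuity in both parameters: g is Lipschitz on the compact interval
    that the arguments t + r th visit. *)
Lemma mean_continuous k g t r : Cinf g ->
  continuous (fun q : R * R => mean k g (fst q) (snd q)) (t, r).
Proof.
intros Hg.
destruct (bounded_on_segment (Derive g) (Rabs t + Rabs r + 2)) as [K [HK HB]].
{ intros; now apply Cinf_continuous, Cinf_Derive. }
apply continuity_2d_pt_filterlim. intros eps.
assert (Hd : 0 < Rmin 1 (eps / (4 * K + 1))).
{ apply Rmin_pos; [lra|]. apply Rdiv_lt_0_compat; [apply eps|lra]. }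
exists (mkposreal _ Hd). simpl. intros t' r' Ht Hr.
assert (Ht1 := Rlt_le_trans _ _ _ Ht (Rmin_l _ _)).
assert (Hr1 := Rlt_le_trans _ _ _ Hr (Rmin_l _ _)).
assert (Ht2 := Rlt_le_trans _ _ _ Ht (Rmin_r _ _)).
assert (Hr2 := Rlt_le_trans _ _ _ Hr (Rmin_r _ _)).
set (d := eps / (4 * K + 1)) in *.
assert (Hd0 : 0 < d) by (apply Rdiv_lt_0_compat; [apply eps|lra]).
assert (Hde : d * (4 * K + 1) = eps) by (unfold d; field; lra).
unfold mean.
rewrite <- (@RInt_minus R_CompleteNormedModule); try now apply ex_mean.
apply Rle_lt_trans with ((1 - -1) * (K * (2 * d))); [|nra].
apply (abs_RInt_le_const); [lra| |].
- apply (@ex_RInt_minus R_NormedModule); now apply ex_mean.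
- intros th Hth. unfold minus, plus, opp; simpl.
  replace (_ + _) with ((g (t' + r' * th) - g (t + r * th)) * weight k th) by ring.
  rewrite Rabs_mult.
  rewrite <- (Rmult_1_r (K * (2 * d))).
  apply Rmult_le_compat; try apply Rabs_pos; [|now apply weight_bound].
  apply Rle_trans with (K * Rabs ((t' + r' * th) - (t + r * th))).
  + apply (bounded_variation g (Derive g)). intros s Hs. split; [now apply Cinf_is_derive|].
    apply HB. revert Hs Ht1 Hr1.
    replace (t' + r' * th - (t + r * th)) with ((t' - t) + (r' - r) * th) by ring.
    intros Hs Ht1 Hr1.
    assert (Rabs (t' - t + (r' - r) * th) <= 2).
    { eapply Rle_trans; [apply Rabs_triang|]. rewrite Rabs_mult.
      assert (Rabs th <= 1) by (apply Rabs_le; lra).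
      pose proof (Rabs_pos th); pose proof (Rabs_pos (r'-r)). nra. }
    assert (Rabs (t + r * th) <= Rabs t + Rabs r).
    { eapply Rle_trans; [apply Rabs_triang|]. rewrite Rabs_mult.
      assert (Rabs th <= 1) by (apply Rabs_le; lra).
      pose proof (Rabs_pos th); pose proof (Rabs_pos r). nra. }
    apply Rabs_le_between.
    replace s with ((s - (t + r * th)) + (t + r * th)) by ring.
    eapply Rle_trans; [apply Rabs_triang|]. lra.
  + apply Rmult_le_compat_l; [lra|].
    replace (t' + r' * th - (t + r * th)) with ((t' - t) + (r' - r) * th) by ring.
    eapply Rle_trans; [apply Rabs_triang|]. rewrite Rabs_mult.
    assert (Rabs th <= 1) by (apply Rabs_le; lra).
    pose proof (Rabs_pos th); pose proof (Rabs_pos (r'-r)). nra.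
Qed.

(** The time derivative is again a mean, hence jointly continuous; together with
    the existence of the radial derivative this gives differentiability. *)
Lemma mean_differentiable k g t r : Cinf g ->
  differentiable_pt_lim (mean k g) t r (mean k (Derive g) t r)
    (r / (2 * INR (S k)) * mean (S k) (Derive (Derive g)) t r).
Proof.
intros Hg. apply filterdiff_differentiable_pt_lim.
apply (is_derive_filterdiff (mean k g) t r (mean k (Derive g))).
- apply filter_forall. intros u. now apply mean_dt.
- now apply mean_dr.
- now apply mean_continuous, Cinf_Derive.
Qed.

(** * Calculus of functions of class C^n *)

Definition is_Ddir {V : NormedModule R_AbsRing} (v : V) (g : V -> R) (x : V) (l : R) : Prop :=
  is_derive (fun h : R => g (plus x (scal h v))) 0 l.

Lemma is_Ddir_unique {V : NormedModule R_AbsRing} (v : V) g x l :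
  is_Ddir v g x l -> Ddir v g x = l.
Proof. apply is_derive_unique. Qed.

Lemma is_Ddir_ex {V : NormedModule R_AbsRing} (v : V) g x l :
  is_Ddir v g x l -> ex_Ddir v g x.
Proof. intros H. now exists l. Qed.

Lemma Ddir_correct {V : NormedModule R_AbsRing} (v : V) g x :
  ex_Ddir v g x -> is_Ddir v g x (Ddir v g x).
Proof. apply Derive_correct. Qed.

Lemma plus_scal_0 {V : NormedModule R_AbsRing} (x v : V) :
  plus x (scal (0 : R) v) = x.
Proof. transitivity (plus x zero); [f_equal; exact (scal_zero_l v)|apply plus_zero_r]. Qed.

Section Ck.

Context {V : NormedModule R_AbsRing}.
Implicit Types g h : V -> R.

Lemma Ck_ext n g h : (forall x, g x = h x) -> Ck n g -> Ck n h.
Proof.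
revert g h; induction n as [|n IH]; intros g h E [Hc Hd]; split.
- intros x. apply (continuous_ext g h); auto.
- exact I.
- intros x. apply (continuous_ext g h); auto.
- intros v. destruct (Hd v) as [He HD]. split.
  + intros x. apply (ex_derive_ext (fun t : R => g (plus x (scal t v)))); [|apply He].
    intros t. apply E.
  + apply (IH (Ddir v g)); [|exact HD].
    intros x. apply Derive_ext. intros t. apply E.
Qed.

Lemma Ck_continuous n g : Ck n g -> forall x, continuous g x.
Proof. now destruct n; intros [H _]. Qed.

(** The criterion used below to climb from C^n to C^(n+1): a formula for the
    directional derivatives, each of class C^n. *)
Lemma Ck_S n g (D : V -> V -> R) : (forall x, continuous g x) ->
  (forall v x, is_Ddir v g x (D v x)) -> (forall v, Ck n (D v)) -> Ck (S n) g.
Proof.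
intros Hc HD Hn. split; [exact Hc|]. intros v. split.
- intros x. eapply is_Ddir_ex, HD.
- apply (Ck_ext n (D v)); [|apply Hn].
  intros x. symmetry. now apply is_Ddir_unique.
Qed.

Lemma Ck_is_Ddir n g : Ck (S n) g -> forall v x, is_Ddir v g x (Ddir v g x).
Proof. intros [_ H] v x. apply Ddir_correct. apply H. Qed.

Lemma Ck_Ddir n g v : Ck (S n) g -> Ck n (Ddir v g).
Proof. intros [_ H]. apply H. Qed.

Lemma Ck_pred n g : Ck (S n) g -> Ck n g.
Proof.
revert g; induction n as [|n IH]; intros g [Hc Hd]; split; trivial.
intros v. destruct (Hd v). auto.
Qed.

Lemma Ck_const n (c : R) : Ck n (fun _ : V => c).
Proof.
revert c; induction n as [|n IH]; intros c.
- split; trivial. intros; apply continuous_const.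
- apply (Ck_S n _ (fun _ _ => 0)); auto.
  + intros; apply continuous_const.
  + intros v x. apply (is_derive_const c 0).
Qed.

Lemma Ck_plus n g h : Ck n g -> Ck n h -> Ck n (fun x => g x + h x).
Proof.
revert g h; induction n as [|n IH]; intros g h Hg Hh.
- split; trivial. intros x. apply (continuous_plus g h); eapply Ck_continuous; eauto.
- apply (Ck_S n _ (fun v x => Ddir v g x + Ddir v h x)).
  + intros x. apply (continuous_plus g h); eapply Ck_continuous; eauto.
  + intros v x.
    apply (is_derive_plus (fun t : R => g (plus x (scal t v))) (fun t : R => h (plus x (scal t v))));
      eapply Ck_is_Ddir; eauto.
  + intros v. apply IH; now apply Ck_Ddir.
Qed.

Lemma Ck_mult n g h : Ck n g -> Ck n h -> Ck n (fun x => g x * h x).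
Proof.
revert g h; induction n as [|n IH]; intros g h Hg Hh.
- split; trivial. intros x. apply (continuous_mult g h); eapply Ck_continuous; eauto.
- apply (Ck_S n _ (fun v x => Ddir v g x * h x + g x * Ddir v h x)).
  + intros x. apply (continuous_mult g h); eapply Ck_continuous; eauto.
  + intros v x.
    pose proof (is_derive_mult (fun t : R => g (plus x (scal t v))) (fun t : R => h (plus x (scal t v)))
      0 _ _ (Ck_is_Ddir _ _ Hg v x) (Ck_is_Ddir _ _ Hh v x) Rmult_comm) as H.
    cbv beta in H. rewrite (plus_scal_0 x v) in H. exact H.
  + intros v. apply Ck_plus; apply IH; (now apply Ck_Ddir) || now apply Ck_pred.
Qed.

Lemma Ck_comp n (phi : R -> R) g : Cinf phi -> Ck n g -> Ck n (fun x => phi (g x)).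
Proof.
revert phi g; induction n as [|n IH]; intros phi g Hphi Hg.
- split; trivial. intros x. apply (continuous_comp g phi).
  + eapply Ck_continuous; eauto. + now apply Cinf_continuous.
- apply (Ck_S n _ (fun v x => Ddir v g x * Derive phi (g x))).
  + intros x. apply (continuous_comp g phi).
    * eapply Ck_continuous; eauto. * now apply Cinf_continuous.
  + intros v x.
    apply (is_derive_eq _ _ (Ddir v g x * Derive phi (g (plus x (scal (0 : R) v)))));
      [|now rewrite plus_scal_0].
    apply (is_derive_comp phi (fun t : R => g (plus x (scal t v)))).
    * now apply Cinf_is_derive.
    * now apply (Ck_is_Ddir n).
  + intros v. apply Ck_mult; [now apply Ck_Ddir|].
    apply IH; [now apply Cinf_Derive|now apply Ck_pred].
Qed.

Lemma smooth_Ddir g v : smooth g -> smooth (Ddir v g).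
Proof. intros Hg n. apply Ck_Ddir, Hg. Qed.

Lemma smooth_is_derive_line g p e s : smooth g ->
  is_derive (fun s : R => g (plus p (scal s e))) s (Ddir e g (plus p (scal s e))).
Proof.
intros Hg.
pose proof (Ck_is_Ddir 0 g (Hg 1%nat) e (plus p (scal s e))) as H. unfold is_Ddir in H.
apply (is_derive_ext (fun s' : R => g (plus (plus p (scal s e)) (scal (s' - s) e)))).
{ intros s'. f_equal. rewrite <- plus_assoc. f_equal.
  transitivity (scal (plus s (s' - s) : R) e); [symmetry; apply (scal_distr_r (K := R_AbsRing))|].
  f_equal. unfold plus; simpl. ring. }
apply (is_derive_eq _ _ (1 * Ddir e g (plus p (scal s e)))); [|ring].
apply (is_derive_comp (fun h : R => g (plus (plus p (scal s e)) (scal h e))) (fun s' => s' - s)).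
- now replace (s - s) with 0 by ring.
- auto_derive; [easy|ring].
Qed.

(** The derivatives along a line are again restrictions of smooth functions
    to that line. *)
Lemma smooth_line g p e : smooth g -> Cinf (fun s : R => g (plus p (scal s e))).
Proof.
intros Hg.
assert (H : forall n, exists h, smooth h /\ forall s,
  Derive_n (fun s : R => g (plus p (scal s e))) n s = h (plus p (scal s e))).
{ induction n as [|n [h [Hh E]]]; [now exists g|].
  exists (Ddir e h). split; [now apply smooth_Ddir|].
  intros s. simpl. rewrite (Derive_ext _ _ _ E).
  now apply is_derive_unique, smooth_is_derive_line. }
intros [|n] x; [exact I|].
destruct (H n) as [h [Hh E]].
apply (ex_derive_ext (fun s : R => h (plus p (scal s e)))); [now intros; symmetry|].
eexists. now apply smooth_is_derive_line.
Qed.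

End Ck.

Lemma Cinf_Ck g n : Cinf g -> Ck (V := R_NormedModule) n g.
Proof.
intros Hg. apply (Ck_comp n g (fun x : R_NormedModule => x) Hg).
destruct n as [|n].
- split; trivial. intros; apply continuous_id.
- apply (Ck_S n _ (fun v _ => v)).
  + intros; apply continuous_id.
  + intros v x. unfold is_Ddir, plus, scal; simpl. unfold mult; simpl.
    auto_derive; [easy|ring].
  + intros v. apply Ck_const.
Qed.

Lemma Ck_Cinf g : (forall n, Ck (V := R_NormedModule) n g) -> Cinf g.
Proof.
intros Hg n x.
apply (ex_derive_n_ext (fun s => g (plus (0 : R_NormedModule) (scal s (1 : R_NormedModule))))).
- intros s. f_equal. unfold plus, scal; simpl. unfold mult; simpl. ring.
- now apply (smooth_line (V := R_NormedModule)).
Qed.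

Lemma Cinf_plus g h : Cinf g -> Cinf h -> Cinf (fun x => g x + h x).
Proof. intros Hg Hh. apply Ck_Cinf. intros n. now apply Ck_plus; apply Cinf_Ck. Qed.

Lemma Cinf_mult g h : Cinf g -> Cinf h -> Cinf (fun x => g x * h x).
Proof. intros Hg Hh. apply Ck_Cinf. intros n. now apply Ck_mult; apply Cinf_Ck. Qed.

Lemma Cinf_comp g h : Cinf g -> Cinf h -> Cinf (fun x => g (h x)).
Proof. intros Hg Hh. apply Ck_Cinf. intros n. apply Ck_comp; [easy|now apply Cinf_Ck]. Qed.

Lemma Cinf_id : Cinf (fun x => x).
Proof.
apply (Cinf_antiderivative _ (fun _ => 1)).
- intros n x. apply ex_derive_n_const.
- intros x. apply (is_derive_id (K := R_AbsRing)).
Qed.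

Lemma Cinf_opp g : Cinf g -> Cinf (fun x => - g x).
Proof. intros Hg n x. apply ex_derive_n_opp, Hg. Qed.
(** * Radial waves on space-time *)

Definition wave (k : nat) (g : R -> R) (q : R4) : R := mean k g (fst q) (enorm (snd q)).

Definition dot (p q : R3) : R :=
  let '(x, y, z) := p in let '(x', y', z') := q in x * x' + y * y' + z * z'.

Lemma enorm_pos p : 0 <= enorm p.
Proof. destruct p as [[x y] z]. apply sqrt_pos. Qed.

Lemma enorm_sqr p : enorm p * enorm p = dot p p.
Proof.
destruct p as [[x y] z]. simpl. rewrite sqrt_sqrt; [ring|].
nra.
Qed.

Lemma mean_comp k g a rho h da drho : Cinf g ->
  is_derive a h da -> is_derive rho h drho ->
  is_derive (fun h => mean k g (a h) (rho h)) h
    (mean k (Derive g) (a h) (rho h) * da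
     + rho h / (2 * INR (S k)) * mean (S k) (Derive (Derive g)) (a h) (rho h) * drho).
Proof.
intros Hg Ha Hrho. apply is_derive_Reals in Ha, Hrho. apply is_derive_Reals.
apply derivable_pt_lim_comp_2d; trivial. now apply mean_differentiable.
Qed.

(** Away from the origin this is the chain rule. At the origin the norm is not
    differentiable, but there the norm |h e| may be replaced by h |e|, since the
    mean is even in its radius. *)
Lemma mean_enorm_line k g (t s x y z a b c : R) : Cinf g ->
  is_derive (fun h : R => mean k g (t + h * s) (enorm (x + h * a, y + h * b, z + h * c))) 0
    (s * mean k (Derive g) t (enorm (x, y, z))
     + (a * x + b * y + c * z) * / (2 * INR (S k))
       * mean (S k) (Derive (Derive g)) t (enorm (x, y, z))).
Proof.
intros Hg.
assert (HN : INR (S k) <> 0) by (apply not_0_INR; lia).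
assert (Ht : is_derive (fun h : R => t + h * s) 0 s).
{ auto_derive; [easy|ring]. }
pose proof (enorm_sqr (x, y, z)) as E. pose proof (enorm_pos (x, y, z)) as Hpos.
simpl dot in E. set (r := enorm (x, y, z)) in *.
destruct (Req_dec r 0) as [H0|H0].
- assert (Hp : x = 0 /\ y = 0 /\ z = 0) by (rewrite H0 in E; nra).
  rewrite H0.
  destruct Hp as [-> [-> ->]].
  set (N := enorm (a, b, c)).
  apply (is_derive_ext (fun h => mean k g (t + h * s) (h * N))).
  { intros h. replace (enorm _) with (Rabs (h * N)).
    - unfold Rabs. destruct (Rcase_abs (h * N)); [|reflexivity].
      symmetry. exact (mean_even k g _ _ Hg).
    - rewrite Rabs_mult, (Rabs_pos_eq N) by apply enorm_pos.
      rewrite <- sqrt_Rsqr_abs. unfold N; simpl.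
      rewrite <- sqrt_mult_alt by apply Rle_0_sqr.
      f_equal. unfold Rsqr. ring. }
  assert (Hl : is_derive (fun h : R => h * N) 0 N) by (auto_derive; [easy|ring]).
  apply (is_derive_eq _ _ _ _ (mean_comp k g _ _ 0 s _ Hg Ht Hl)).
  replace (t + 0 * s) with t by ring. replace (0 * N) with 0 by ring.
  field. exact HN.
- assert (Hr : is_derive (fun h => enorm (x + h * a, y + h * b, z + h * c)) 0
    ((a * x + b * y + c * z) / r)).
  { unfold enorm. auto_derive.
    - assert (0 < r * r) by nra. rewrite !Rmult_0_l, !Rplus_0_r, !Rmult_1_r. lra.
    - replace (sqrt _) with r; [field; trivial|].
      unfold r, enorm. f_equal. ring. }
  apply (is_derive_eq _ _ _ _ (mean_comp k g _ _ 0 s _ Hg Ht Hr)).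
  replace (t + 0 * s) with t by ring.
  replace (enorm (x + 0 * a, y + 0 * b, z + 0 * c)) with r
    by (unfold r, enorm; f_equal; ring).
  field. auto.
Qed.

(** The derivatives of a wave are combinations of waves with polynomial
    coefficients: this class of functions is closed under differentiation, which
    gives smoothness by induction. *)
Lemma wave_is_Ddir k g (v q : R4) : Cinf g ->
  is_Ddir v (wave k g) q
    (fst v * wave k (Derive g) q
     + dot (snd v) (snd q) * / (2 * INR (S k)) * wave (S k) (Derive (Derive g)) q).
Proof.
intros Hg. destruct q as [t [[x y] z]], v as [s [[a b] c]].
exact (mean_enorm_line k g t s x y z a b c Hg).
Qed.

Lemma continuous_enorm (p : R3) : continuous enorm p.
Proof.
destruct p as [[x y] z].
apply (continuous_ext (fun p : R3 => sqrt (fst (fst p) * fst (fst p) + snd (fst p) * snd (fst p) + snd p * snd p))).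
{ intros [[x' y'] z']. simpl. f_equal. ring. }
apply (continuous_comp (fun p : R3 => fst (fst p) * fst (fst p) + snd (fst p) * snd (fst p) + snd p * snd p) sqrt);
  [|apply continuous_sqrt].
assert (H1 : continuous (fun p : R3 => fst (fst p)) (x, y, z)).
{ apply (continuous_comp (fun p : R3 => fst p) fst); apply continuous_fst. }
assert (H2 : continuous (fun p : R3 => snd (fst p)) (x, y, z)).
{ apply (continuous_comp (fun p : R3 => fst p) snd); [apply continuous_fst|apply continuous_snd]. }
assert (H3 : continuous (fun p : R3 => snd p) (x, y, z)) by apply continuous_snd.
apply (continuous_plus (fun p : R3 => fst (fst p) * fst (fst p) + snd (fst p) * snd (fst p)) (fun p : R3 => snd p * snd p)).
2: now apply (continuous_mult (fun p : R3 => snd p) (fun p : R3 => snd p)).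
apply (continuous_plus (fun p : R3 => fst (fst p) * fst (fst p)) (fun p : R3 => snd (fst p) * snd (fst p))).
- now apply (continuous_mult (fun p : R3 => fst (fst p)) (fun p : R3 => fst (fst p))).
- now apply (continuous_mult (fun p : R3 => snd (fst p)) (fun p : R3 => snd (fst p))).
Qed.

Lemma wave_continuous k g q : Cinf g -> continuous (wave k g) q.
Proof.
intros Hg. apply (continuous_comp_2 (fun q : R4 => fst q) (fun q : R4 => enorm (snd q)) (mean k g)).
- apply continuous_fst.
- apply (continuous_comp (fun q : R4 => snd q) enorm); [apply continuous_snd|apply continuous_enorm].
- now apply mean_continuous.
Qed.

Lemma dot_Ck n (e : R3) : Ck n (fun q : R4 => dot e (snd q)).
Proof.
assert (H : forall x' y' z' x y z a b c : R, is_derive (fun h : R =>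
  x' * (x + h * a) + y' * (y + h * b) + z' * (z + h * c)) 0 (x' * a + y' * b + z' * c)).
{ intros. auto_derive; [easy|ring]. }
assert (HD : forall v q : R4, is_Ddir v (fun q : R4 => dot e (snd q)) q (dot e (snd v))).
{ intros [s [[a b] c]] [t [[x y] z]]. destruct e as [[x' y'] z'].
  exact (H x' y' z' x y z a b c). }
assert (HC : forall q : R4, continuous (fun q : R4 => dot e (snd q)) q).
{ intros [t [[x y] z]]. destruct e as [[x' y'] z'].
  apply (continuous_ext (fun q : R4 => x' * fst (fst (snd q)) + y' * snd (fst (snd q)) + z' * snd (snd q))).
  { intros [t' [[a b] c]]. reflexivity. }
  apply (continuous_comp (fun q : R4 => snd q) (fun p : R3 => x' * fst (fst p) + y' * snd (fst p) + z' * snd p)); [apply continuous_snd|].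
  apply (continuous_plus (fun p : R3 => x' * fst (fst p) + y' * snd (fst p)) (fun p : R3 => z' * snd p)).
  apply (continuous_plus (fun p : R3 => x' * fst (fst p)) (fun p : R3 => y' * snd (fst p))).
  - apply (continuous_scal_r x' (fun p : R3 => fst (fst p))).
    apply (continuous_comp (fun p : R3 => fst p) fst); apply continuous_fst.
  - apply (continuous_scal_r y' (fun p : R3 => snd (fst p))).
    apply (continuous_comp (fun p : R3 => fst p) snd); [apply continuous_fst|apply continuous_snd].
  - apply (continuous_scal_r z' (fun p : R3 => snd p)). apply continuous_snd. }
destruct n as [|n]; [split; [exact HC|exact I]|].
apply (Ck_S n _ (fun v _ => dot e (snd v)) HC HD). intros; apply Ck_const.
Qed.

Lemma wave_Ck n k g : Cinf g -> Ck n (wave k g).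
Proof.
revert k g; induction n as [|n IH]; intros k g Hg.
- split; trivial. intros; now apply wave_continuous.
- assert (Hg' := Cinf_Derive _ Hg).
  apply (Ck_S n _ _ (fun q => wave_continuous k g q Hg) (fun v q => wave_is_Ddir k g v q Hg)).
  intros v. apply Ck_plus.
  + apply Ck_mult; [apply Ck_const|auto].
  + apply Ck_mult; [|apply IH; now apply Cinf_Derive].
    apply (Ck_mult n _ (fun _ => / (2 * INR (S k)))); [apply dot_Ck|apply Ck_const].
Qed.

(** * Radial solutions of the linear wave equation *)

Lemma mean_0 g t r : mean 0 g t r = RInt (fun th => g (t + r * th)) (-1) 1.
Proof. unfold mean. apply RInt_ext. intros. unfold weight. simpl. apply Rmult_1_r. Qed.

Lemma mean_radius_0 g s : mean 0 g s 0 = 2 * g s.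
Proof.
rewrite mean_0. rewrite (RInt_ext _ (fun _ => g s)).
- rewrite RInt_const. unfold scal; simpl. unfold mult; simpl. ring.
- intros x _. f_equal. ring.
Qed.

(** The right-hand side is what the Laplacian of [mean 0 g t |x|] amounts to when
    h = g'', as the left-hand side is its second time derivative. Both agree
    after one integration by parts against th (1 - th^2). *)
Lemma mean_wave_equation h t r : Cinf h ->
  mean 0 h t r = 3 / 2 * mean 1 h t r + r ^ 2 / 8 * mean 2 (Derive (Derive h)) t r.
Proof.
intros Hh.
pose proof (mean_by_parts 1 (Derive h) t r (Cinf_Derive _ Hh)) as H1.
pose proof (segment_by_parts h (fun th => th * weight 1 th) (fun th => 1 - 3 * th ^ 2) t r Hh) as H2.
lapply H2; clear H2; [intros H2|].
2: { intros x. unfold weight. auto_derive; [easy|ring]. }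
lapply H2; clear H2; [intros H2|].
2: { intros x. apply (ex_derive_continuous (fun th => 1 - 3 * th ^ 2)). auto_derive. easy. }
rewrite H1 in H2.
replace (RInt (fun th => h (t + r * th) * (1 - 3 * th ^ 2)) (-1) 1)
  with (3 * mean 1 h t r - 2 * mean 0 h t r) in H2.
- unfold weight in H2. simpl INR in H2. simpl in H2 |- *. lra.
- symmetry. unfold mean.
  rewrite (RInt_ext _ (fun th => 3 * (h (t + r * th) * weight 1 th) + -2 * (h (t + r * th) * weight 0 th))).
  + rewrite RInt_linear by (intros; now apply mean_integrand_continuous). ring.
  + intros x _. unfold weight. simpl. ring.
Qed.

(** With v half of the mean, this reads v + r v_r = (g(t + r) + g(t - r)) / 2. *)
Lemma mean_dr_endpoints g t r dv : Cinf g ->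
  is_derive (fun r => mean 0 g t r) r dv ->
  mean 0 g t r + r * dv = g (t + r) + g (t - r).
Proof.
intros Hg Hd.
replace dv with (RInt (fun th => Derive g (t + r * th) * (th * weight 0 th)) (-1) 1).
2: { rewrite <- (is_derive_unique _ _ _ Hd). symmetry. now apply is_derive_unique, mean_dr_raw. }
pose proof (segment_by_parts g (fun th => th * weight 0 th) (weight 0) t r Hg) as H.
unfold mean. rewrite Rplus_comm. rewrite H.
- unfold weight. simpl. ring.
- intros x. unfold weight. simpl. auto_derive; [easy|ring].
- intros x. apply weight_continuous.
Qed.

Lemma mean_dt_endpoints g t r : Cinf g ->
  r * mean 0 (Derive g) t r = g (t + r) - g (t - r).
Proof.
intros Hg.
pose proof (segment_by_parts g (weight 0) (fun _ => 0) t r Hg) as H.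
rewrite (RInt_ext (fun th => g (t + r * th) * 0) (fun _ => 0)) in H by (intros; simpl; apply Rmult_0_r).
rewrite RInt_const in H. unfold scal in H; simpl in H. unfold mult in H; simpl in H.
unfold mean. unfold weight in *. simpl in *. rewrite <- (Rmult_1_r (g (t + r))), <- (Rmult_1_r (g (t - r))).
rewrite <- H.
- ring.
- intros x. auto_derive; [easy|ring].
- intros x. apply continuous_const.
Qed.

(** An average of a continuous function is one of its values. *)
Lemma mean_attained g t r : Cinf g -> exists s, mean 0 g t r = 2 * g s.
Proof.
intros Hg. rewrite mean_0. set (h := fun th => g (t + r * th)).
assert (Hc : forall x, continuous h x) by (intros; now apply affine_continuous).
assert (Hex : forall x, ex_RInt h (-1) x).
{ intros x. apply (@ex_RInt_continuous R_CompleteNormedModule). auto. }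
assert (HD : forall x, is_derive (RInt h (-1)) x (h x)).
{ intros x. apply (is_derive_RInt h (RInt h (-1)) (-1)); [|apply Hc].
  apply filter_forall. intros y. apply (@RInt_correct R_CompleteNormedModule), Hex. }
destruct (MVT_gen (RInt h (-1)) (-1) 1 h) as [c [_ E]].
- intros; apply HD.
- intros x _. apply continuity_pt_filterlim. apply (ex_derive_continuous (RInt h (-1))).
  eexists; apply HD.
- exists (t + r * c). rewrite (RInt_point (-1) h) in E. unfold zero in E; simpl in E.
  fold (h c). lra.
Qed.

(** * Initial data of the linear wave equation *)

(** When v has the initial data v0 and v1, this is twice the derivative of the
    function A in the decomposition r v = A(t + r) - A(t - r). *)
Definition transport (v0 v1 : R -> R) (s : R) : R := v0 s + s * Derive v0 s + s * v1 s.

Lemma transport_Cinf v0 v1 : Cinf v0 -> Cinf v1 -> Cinf (transport v0 v1).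
Proof.
intros H0 H1. apply (Cinf_plus (fun s => v0 s + s * Derive v0 s) (fun s => s * v1 s)).
- apply (Cinf_plus v0 (fun s => s * Derive v0 s)); trivial.
  apply Cinf_mult; [apply Cinf_id|now apply Cinf_Derive].
- apply Cinf_mult; [apply Cinf_id|trivial].
Qed.

Lemma Derive_even v x : Cinf v -> (forall x, v (- x) = v x) -> Derive v (- x) = - Derive v x.
Proof.
intros Hv He. rewrite <- (Ropp_involutive (Derive v (- x))). f_equal. symmetry.
apply is_derive_unique. apply (is_derive_ext (fun x => v (- x))); [exact He|].
apply (is_derive_eq _ _ (-1 * Derive v (- x))); [|ring].
apply (is_derive_comp v Ropp); [now apply Cinf_is_derive|].
auto_derive; [easy|ring].
Qed.

Section InitialData.

Variables v0 v1 : R -> R.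
Hypotheses (H0 : Cinf v0) (H1 : Cinf v1).
Hypotheses (E0 : forall x, v0 (- x) = v0 x) (E1 : forall x, v1 (- x) = v1 x).

(** The contribution of s v1(s) is odd and cancels, and the rest is the
    derivative of s v0(s), whose average over [-r, r] is v0(r). *)
Lemma transport_mean r : mean 0 (transport v0 v1) 0 r = 2 * v0 r.
Proof.
rewrite mean_0.
set (A := fun th => Derive v0 (0 + r * th) * th).
set (B := fun th => v0 (0 + r * th) * 1).
set (C := fun th => r * th * v1 (r * th)).
assert (Hid : forall th, continuous (fun th : R => th) th) by (intros; apply continuous_id).
assert (HA : forall th, continuous A th).
{ intros th. apply (continuous_mult (fun th => Derive v0 (0 + r * th)) (fun th => th)); trivial.
  now apply affine_continuous, Cinf_Derive. }
assert (HB : forall th, continuous B th).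
{ intros th. apply (continuous_mult (fun th => v0 (0 + r * th)) (fun _ => 1)).
  - now apply affine_continuous. - apply continuous_const. }
assert (HC : forall th, continuous C th).
{ intros th. apply (continuous_comp (fun th => r * th) (fun s => s * v1 s)).
  - apply (ex_derive_continuous (fun th => r * th)). auto_derive. easy.
  - apply (continuous_mult (fun s => s) v1); trivial. now apply Cinf_continuous. }
rewrite (RInt_ext _ (fun th => 1 * (r * A th + 1 * B th) + 1 * C th)).
2: { intros x _. unfold transport, A, B, C. simpl. rewrite Rplus_0_l. ring. }
rewrite RInt_linear; trivial.
2: { intros x. apply (continuous_plus (fun x => r * A x) (fun x => 1 * B x)).
  - apply (continuous_scal_r r A), HA. - apply (continuous_scal_r 1 B), HB. }
rewrite RInt_linear, (RInt_odd C HC); trivial.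
2: { intros x. unfold C. replace (r * - x) with (- (r * x)) by ring. rewrite E1. ring. }
pose proof (segment_by_parts v0 (fun th => th) (fun _ => 1) 0 r H0) as H.
replace (0 - r) with (- r) in H by ring. rewrite Rplus_0_l in H. rewrite E0 in H.
fold A B in H. rewrite Rmult_1_l, (Rmult_1_l (RInt B _ _)), H.
- ring.
- intros x. apply (is_derive_id (K := R_AbsRing)).
- intros x. apply continuous_const.
Qed.

Lemma transport_dt_mean r : mean 0 (Derive (transport v0 v1)) 0 r = 2 * v1 r.
Proof.
destruct (Req_dec r 0) as [->|Hr].
- rewrite mean_radius_0. f_equal. apply is_derive_unique. unfold transport.
  assert (HD0 : Derive v0 0 = 0).
  { pose proof (Derive_even v0 0 H0 E0) as H. rewrite Ropp_0 in H. lra. }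
  pose proof (Cinf_is_derive v0 0 H0) as A1.
  pose proof (Cinf_is_derive _ 0 (Cinf_Derive _ H0)) as A2.
  pose proof (Cinf_is_derive _ 0 H1) as A3.
  pose proof (is_derive_id (K := R_AbsRing) 0) as A4.
  eapply is_derive_eq.
  + apply (is_derive_plus (fun s => v0 s + s * Derive v0 s) (fun s => s * v1 s)).
    * apply (is_derive_plus v0 (fun s => s * Derive v0 s)); [exact A1|].
      exact (is_derive_mult (fun s => s) (Derive v0) 0 _ _ A4 A2 Rmult_comm).
    * exact (is_derive_mult (fun s => s) v1 0 _ _ A4 A3 Rmult_comm).
  + rewrite HD0. unfold plus, mult, one; simpl. ring.
- apply (Rmult_eq_reg_l r); trivial.
  rewrite mean_dt_endpoints by now apply transport_Cinf.
  unfold transport. rewrite Rplus_0_l. replace (0 - r) with (- r) by ring.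
  rewrite (Derive_even v0 r H0 E0), E0, E1. ring.
Qed.

End InitialData.

(** * The transformation F *)

(** The reciprocal of the derivative of F. Its own derivative is f E, which is
    where the nonlinearity of the equation comes from. *)
Definition E (f : R -> R) (w : R) : R := exp (RInt f 0 w).

Lemma E_pos f w : 0 < E f w.
Proof. apply exp_pos. Qed.

Lemma RInt_is_derive (h : R -> R) x : (forall x, continuous h x) -> is_derive (RInt h 0) x (h x).
Proof.
intros Hh. apply (is_derive_RInt h (RInt h 0) 0); [|apply Hh].
apply filter_forall. intros y. apply (@RInt_correct R_CompleteNormedModule).
now apply ex_RInt_cont.
Qed.

Lemma RInt_Cinf h : Cinf h -> Cinf (RInt h 0).
Proof.
intros Hh. apply (Cinf_antiderivative _ h Hh). intros x.
apply RInt_is_derive. intros; now apply Cinf_continuous.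
Qed.

Lemma E_Cinf f : Cinf f -> Cinf (E f).
Proof. intros Hf. apply (Cinf_comp exp (RInt f 0)); [apply Cinf_exp|now apply RInt_Cinf]. Qed.

Lemma E_derive f w : Cinf f -> is_derive (E f) w (f w * E f w).
Proof.
intros Hf. apply (is_derive_comp exp (RInt f 0)).
- apply is_derive_exp.
- apply RInt_is_derive. intros; now apply Cinf_continuous.
Qed.

Lemma E_opp f w : exp (- RInt f 0 w) = / E f w.
Proof. apply exp_Ropp. Qed.

Lemma F_integrand_Cinf f : Cinf f -> Cinf (fun s => exp (- RInt f 0 s)).
Proof.
intros Hf. apply (Cinf_comp exp (fun s => - RInt f 0 s)); [apply Cinf_exp|].
now apply Cinf_opp, RInt_Cinf.
Qed.

Lemma F_derive f w : Cinf f -> is_derive (F f) w (/ E f w).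
Proof.
intros Hf. rewrite <- E_opp.
apply (RInt_is_derive (fun s => exp (- RInt f 0 s))).
intros; now apply Cinf_continuous, F_integrand_Cinf.
Qed.

Lemma F_Cinf f : Cinf f -> Cinf (F f).
Proof. intros Hf. now apply (RInt_Cinf (fun s => exp (- RInt f 0 s))), F_integrand_Cinf. Qed.

Lemma F_lt f x y : Cinf f -> x < y -> F f x < F f y.
Proof.
intros Hf Hxy.
destruct (MVT_gen (F f) x y (fun w => / E f w)) as [c [_ H]].
- intros; now apply F_derive.
- intros z _. apply continuity_pt_filterlim. now apply Cinf_continuous, F_Cinf.
- assert (0 < / E f c) by apply Rinv_0_lt_compat, E_pos. nra.
Qed.

Lemma F_le f x y : Cinf f -> x <= y -> F f x <= F f y.
Proof. intros Hf [H|<-]; [left; now apply F_lt|right; reflexivity]. Qed.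

Lemma F_le_inv f x y : Cinf f -> F f x <= F f y -> x <= y.
Proof.
intros Hf H. destruct (Rle_lt_dec x y) as [|Hyx]; trivial.
apply (F_lt f) in Hyx; trivial. lra.
Qed.

Lemma F_inj f x y : Cinf f -> F f x = F f y -> x = y.
Proof. intros Hf H. apply Rle_antisym; apply (F_le_inv f); trivial; lra. Qed.

(** ** Limits at infinity of an increasing function *)

(** Without a finite limit at minus infinity an increasing function takes
    arbitrarily low values; this lets the bounded and the unbounded cases of F
    be treated together. *)
Lemma increasing_below (G : R -> R) y : (forall x x', x <= x' -> G x <= G x') ->
  (forall a : R, is_lim G m_infty a -> a < y) -> exists w, G w < y.
Proof.
intros HG Ha. destruct (classic (exists w, G w < y)) as [|Hn]; trivial. exfalso.
assert (Hy : forall w, y <= G w).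
{ intros w. destruct (Rle_lt_dec y (G w)); trivial. exfalso. eauto. }
destruct (completeness (fun z => exists w, z = - G w)) as [m [Hub Hlub]].
- exists (- y). intros z [w ->]. specialize (Hy w). lra.
- exists (- G 0). now exists 0.
- assert (Hm : y <= - m).
  { assert (m <= - y); [|lra]. apply Hlub. intros z [w ->]. specialize (Hy w). lra. }
  cut (is_lim G m_infty (- m)); [intros Hlim; apply Ha in Hlim; lra|].
  apply is_lim_spec. intros eps. simpl.
  destruct (classic (exists w, G w < - m + eps)) as [[w Hw]|Hno].
  + exists w. intros x Hx.
    assert (G x <= G w) by (apply HG; lra).
    assert (- m <= G x).
    { assert (- G x <= m); [|lra]. apply Hub. now exists x. }
    apply Rabs_def1; lra.
  + exfalso. assert (m <= m - eps); [|pose proof (cond_pos eps); lra].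
    apply Hlub. intros z [w ->].
    destruct (Rle_lt_dec (- G w) (m - eps)); trivial. exfalso. apply Hno. exists w. lra.
Qed.

(** Reflection of the previous lemma through the origin. *)
Lemma increasing_above (G : R -> R) y : (forall x x', x <= x' -> G x <= G x') ->
  (forall b : R, is_lim G p_infty b -> y < b) -> exists w, y < G w.
Proof.
intros HG Hb.
destruct (increasing_below (fun x => - G (- x)) (- y)) as [w Hw].
- intros x x' Hx. assert (G (- x') <= G (- x)) by (apply HG; lra). lra.
- intros a Ha. assert (y < - a); [|lra]. apply Hb.
  apply is_lim_spec in Ha. hnf in Ha. apply is_lim_spec. intros eps.
  destruct (Ha eps) as [M HM]. exists (- M). intros x Hx.
  specialize (HM (- x)). rewrite Ropp_involutive in HM.
  replace (G x - - a) with (- (- G x - a)) by ring. rewrite Rabs_Ropp. apply HM. lra.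
- exists (- w). lra.
Qed.

Lemma F_lower_limit f (a w : R) : Cinf f -> is_lim (F f) m_infty a -> a < F f w.
Proof.
intros Hf Ha. apply Rle_lt_trans with (F f (w - 1)); [|apply F_lt; trivial; lra].
apply Rnot_lt_le. intros H. apply is_lim_spec in Ha. hnf in Ha.
destruct (Ha (mkposreal (a - F f (w - 1)) ltac:(lra))) as [M HM]. simpl in HM.
set (x := Rmin (w - 1) (M - 1)).
assert (Hx : x < M) by (pose proof (Rmin_r (w - 1) (M - 1)); unfold x; lra).
apply HM in Hx. apply Rabs_def2 in Hx.
assert (F f x <= F f (w - 1)) by (apply F_le; trivial; apply Rmin_l). lra.
Qed.

Lemma F_upper_limit f (b w : R) : Cinf f -> is_lim (F f) p_infty b -> F f w < b.
Proof.
intros Hf Ha. apply Rlt_le_trans with (F f (w + 1)); [apply F_lt; trivial; lra|].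
apply Rnot_lt_le. intros H. apply is_lim_spec in Ha. hnf in Ha.
destruct (Ha (mkposreal (F f (w + 1) - b) ltac:(lra))) as [M HM]. simpl in HM.
set (x := Rmax (w + 1) (M + 1)).
assert (Hx : M < x) by (pose proof (Rmax_r (w + 1) (M + 1)); unfold x; lra).
apply HM in Hx. apply Rabs_def2 in Hx.
assert (F f (w + 1) <= F f x) by (apply F_le; trivial; apply Rmax_l). lra.
Qed.

Lemma F_range f y : Cinf f ->
  (forall a : R, is_lim (F f) m_infty a -> a < y) ->
  (forall b : R, is_lim (F f) p_infty b -> y < b) -> exists w, F f w = y.
Proof.
intros Hf Ha Hb.
destruct (increasing_below (F f) y (fun x x' => F_le f x x' Hf) Ha) as [w1 H1].
destruct (increasing_above (F f) y (fun x x' => F_le f x x' Hf) Hb) as [w2 H2].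
destruct (IVT_gen (F f) w1 w2 y) as [w [_ Hw]].
- intros x. apply continuity_pt_filterlim. now apply Cinf_continuous, F_Cinf.
- rewrite Rmin_left, Rmax_right by lra. lra.
- now exists w.
Qed.

(** ** The integrals over half-lines *)

(** The integrand is F'(s) / F'(w). *)
Lemma is_RInt_exp f s1 s2 w : Cinf f ->
  is_RInt (fun s => exp (RInt f s w)) s1 s2 (E f w * (F f s2 - F f s1)).
Proof.
intros Hf.
assert (Hex : forall a b, ex_RInt f a b).
{ intros. apply ex_RInt_cont. intros; now apply Cinf_continuous. }
assert (HE : forall s, exp (RInt f s w) = / E f s * E f w).
{ intros s. rewrite <- E_opp. unfold E. rewrite <- exp_plus. f_equal.
  pose proof (RInt_Chasles f 0 s w (Hex _ _) (Hex _ _)) as H. unfold plus in H; simpl in H. lra. }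
apply (is_RInt_ext (fun s => / E f s * E f w)); [intros; now rewrite HE|].
replace (E f w * (F f s2 - F f s1)) with (minus (F f s2 * E f w) (F f s1 * E f w))
  by (unfold minus, plus, opp; simpl; ring).
apply (is_RInt_derive (fun s => F f s * E f w)).
- intros s _. now apply is_derive_mult_const, F_derive.
- intros s _. apply (continuous_mult (fun s => / E f s) (fun _ => E f w)).
  + apply (continuous_ext (fun s => exp (- RInt f 0 s))); [intros; apply E_opp|].
    now apply Cinf_continuous, F_integrand_Cinf.
  + apply continuous_const.
Qed.

Lemma F_Derive f w : Cinf f -> Derive (F f) w = / E f w.
Proof. intros Hf. now apply is_derive_unique, F_derive. Qed.

Lemma lower_is_RInt_gen f (a w : R) : Cinf f -> is_lim (F f) m_infty a ->
  is_RInt_gen (fun s => exp (RInt f s w)) (Rbar_locally m_infty) (at_point w)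
    ((F f w - a) * E f w).
Proof.
intros Hf Ha P HP.
assert (HL : is_lim (fun s => E f w * (F f w - F f s)) m_infty ((F f w - a) * E f w)).
{ rewrite Rmult_comm. apply (is_lim_scal_l (fun s => F f w - F f s) (E f w) m_infty (F f w - a)).
  apply is_lim_minus'; [apply is_lim_const|exact Ha]. }
apply (Filter_prod _ _ _ (fun s => P (E f w * (F f w - F f s))) (fun y => y = w)).
- exact (HL P HP).
- reflexivity.
- intros s y Hs ->. exists (E f w * (F f w - F f s)). split; [now apply is_RInt_exp|exact Hs].
Qed.

Lemma upper_is_RInt_gen f (b w : R) : Cinf f -> is_lim (F f) p_infty b ->
  is_RInt_gen (fun s => exp (RInt f s w)) (at_point w) (Rbar_locally p_infty)
    ((b - F f w) * E f w).
Proof.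
intros Hf Hb P HP.
assert (HL : is_lim (fun s => E f w * (F f s - F f w)) p_infty ((b - F f w) * E f w)).
{ rewrite Rmult_comm. apply (is_lim_scal_l (fun s => F f s - F f w) (E f w) p_infty (b - F f w)).
  apply is_lim_minus'; [exact Hb|apply is_lim_const]. }
apply (Filter_prod _ _ _ (fun y => y = w) (fun s => P (E f w * (F f s - F f w)))).
- reflexivity.
- exact (HL P HP).
- intros y s -> Hs. exists (E f w * (F f s - F f w)). split; [now apply is_RInt_exp|exact Hs].
Qed.

Lemma lower_int_eq f (a w : R) : Cinf f -> is_lim (F f) m_infty a ->
  lower_int f w = (F f w - a) * E f w.
Proof.
intros Hf Ha. unfold lower_int.
apply (is_RInt_gen_unique (fun s => exp (RInt f s w))).
exact (lower_is_RInt_gen f a w Hf Ha).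
Qed.

Lemma upper_int_eq f (b w : R) : Cinf f -> is_lim (F f) p_infty b ->
  upper_int f w = (b - F f w) * E f w.
Proof.
intros Hf Hb. unfold upper_int.
apply (is_RInt_gen_unique (fun s => exp (RInt f s w))).
exact (upper_is_RInt_gen f b w Hf Hb).
Qed.

(** ** Inverting F *)

Lemma inverse_continuous {U : UniformSpace} f (u v : U -> R) x : Cinf f ->
  (forall x, F f (u x) = v x) -> continuous v x -> continuous u x.
Proof.
intros Hf Huv Hv. apply filterlim_locally. intros eps.
pose proof (cond_pos eps) as He.
assert (H1 : F f (u x - eps) < v x) by (rewrite <- Huv; apply F_lt; trivial; lra).
assert (H2 : v x < F f (u x + eps)) by (rewrite <- Huv; apply F_lt; trivial; lra).
assert (Hd : 0 < Rmin (v x - F f (u x - eps)) (F f (u x + eps) - v x)) by (apply Rmin_pos; lra).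
pose proof (proj1 (filterlim_locally _ _) Hv (mkposreal _ Hd)) as H.
revert H. apply filter_imp. intros y Hy.
change (Rabs (v y - v x) < Rmin (v x - F f (u x - eps)) (F f (u x + eps) - v x)) in Hy.
change (Rabs (u y - u x) < eps).
pose proof (Rmin_l (v x - F f (u x - eps)) (F f (u x + eps) - v x)).
pose proof (Rmin_r (v x - F f (u x - eps)) (F f (u x + eps) - v x)).
apply Rabs_def2 in Hy. rewrite <- (Huv y) in Hy.
apply Rabs_def1.
- apply Rnot_le_lt. intros Hle.
  assert (F f (u x + eps) <= F f (u y)) by (apply F_le; trivial; lra). lra.
- apply Rnot_le_lt. intros Hle.
  assert (F f (u y) <= F f (u x - eps)) by (apply F_le; trivial; lra). lra.
Qed.

Lemma is_derive_lim (g : R -> R) x l :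
  is_derive g x l <-> is_lim (fun h => (g (x + h) - g x) / h) 0 l.
Proof.
split.
- intros H. apply is_derive_Reals in H. apply is_lim_spec. intros eps.
  destruct (H eps (cond_pos eps)) as [d Hd]. exists d. intros y Hy Hy0.
  apply Hd; trivial. change (Rabs (y - 0) < d) in Hy. now rewrite Rminus_0_r in Hy.
- intros H. apply is_derive_Reals. intros eps Heps. apply is_lim_spec in H. hnf in H.
  destruct (H (mkposreal eps Heps)) as [d Hd]. exists d. intros h Hh0 Hh.
  apply (Hd h); trivial. change (Rabs (h - 0) < d). now rewrite Rminus_0_r.
Qed.

(** Dividing the difference quotient of [v] by the slope of [F] between
    [u x] and [u (x + h)] gives the difference quotient of [u]. *)
Lemma inverse_is_derive f (u v : R -> R) x l : Cinf f ->
  (forall x, F f (u x) = v x) -> is_derive v x l -> is_derive u x (l * E f (u x)).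
Proof.
intros Hf Huv Hv.
assert (Hu : continuous u x).
{ apply (inverse_continuous f u v x Hf Huv). apply (ex_derive_continuous v). now exists l. }
set (A := u x).
set (slope := fun b => if Req_EM_T b A then / E f A else (F f b - F f A) / (b - A)).
assert (HA : slope A = / E f A).
{ unfold slope. now destruct (Req_EM_T A A). }
assert (Hs : continuous slope A).
{ apply continuity_pt_filterlim. intros eps Heps.
  pose proof (F_derive f A Hf) as HD. apply is_derive_Reals in HD.
  destruct (HD eps Heps) as [d Hd]. exists d. split; [apply d|].
  intros b [[_ Hne] Hb]. simpl in *. unfold R_dist in *. rewrite HA.
  unfold slope. destruct (Req_EM_T b A) as [->|Hb']; [now destruct Hne|].
  specialize (Hd (b - A)). replace (A + (b - A)) with b in Hd by ring.
  apply Hd; trivial. lra. }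
apply is_derive_lim in Hv. apply is_derive_lim.
assert (Hsu : is_lim (fun h => slope (u (x + h))) 0 (/ E f A)).
{ pose proof (is_lim_continuity (fun h => slope (u (x + h))) 0) as H.
  cbv beta in H. rewrite Rplus_0_r in H. fold A in H. rewrite HA in H. apply H.
  apply continuity_pt_filterlim. apply (continuous_comp (fun h => u (x + h)) slope).
  - apply (continuous_comp (fun h => x + h) u).
    + apply (ex_derive_continuous (fun h => x + h)). auto_derive. easy.
    + now rewrite Rplus_0_r.
  - now rewrite Rplus_0_r. }
pose proof (E_pos f A) as HE.
replace (l * E f A) with (l / / E f A) by (field; lra).
apply (is_lim_ext_loc (fun h => (v (x + h) - v x) / h / slope (u (x + h)))).
- exists (mkposreal 1 Rlt_0_1). intros h _ Hh.
  rewrite <- !Huv. fold A. unfold slope.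
  destruct (Req_EM_T (u (x + h)) A) as [->|Hne].
  + unfold Rdiv. ring.
  + assert (F f (u (x + h)) <> F f A) by (intros H; now apply F_inj in H).
    field. repeat split; trivial; lra.
- apply (is_lim_div _ _ 0 l (/ E f A) Hv Hsu).
  + intros H. injection H. apply Rinv_neq_0_compat. lra.
  + simpl. trivial.
Qed.

(** The derivative of u is that of v times E(u), so each degree of regularity of
    u gives the next one. *)
Lemma inverse_Ck {V : NormedModule R_AbsRing} f n (u v : V -> R) : Cinf f ->
  (forall x, F f (u x) = v x) -> Ck n v -> Ck n u.
Proof.
intros Hf Huv. induction n as [|n IH]; intros Hv.
- split; trivial. intros x. apply (inverse_continuous f u v x Hf Huv), (Ck_continuous 0 v Hv).
- apply (Ck_S n _ (fun w x => Ddir w v x * E f (u x))).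
  + intros x. apply (inverse_continuous f u v x Hf Huv), (Ck_continuous _ v Hv).
  + intros w x.
    apply (is_derive_eq _ _ (Ddir w v x * E f (u (plus x (scal (0 : R) w))))).
    * apply (inverse_is_derive f (fun h : R => u (plus x (scal h w))) (fun h : R => v (plus x (scal h w))) 0); trivial.
      now apply (Ck_is_Ddir n).
    * now rewrite plus_scal_0.
  + intros w. apply Ck_mult; [now apply Ck_Ddir|].
    apply Ck_comp; [now apply E_Cinf|]. apply IH. now apply Ck_pred.
Qed.

(** Summed with signs over the coordinates of space-time, the last term gives the
    nonlinearity, and the first one E(u) times the linear wave operator. *)
Lemma inverse_Derive2 f (u v v' : R -> R) x l : Cinf f ->
  (forall s, F f (u s) = v s) -> (forall s, is_derive v s (v' s)) -> is_derive v' x l ->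
  Derive_n u 2 x = E f (u x) * l + f (u x) * Derive u x ^ 2.
Proof.
intros Hf Huv Hv Hl.
assert (Hu : forall s, is_derive u s (v' s * E f (u s))).
{ intros s. apply (inverse_is_derive f u v); auto. }
rewrite (is_derive_unique _ _ _ (Hu x)).
simpl. rewrite (Derive_ext (fun s => Derive u s) (fun s => v' s * E f (u s)))
  by (intros s; apply is_derive_unique, Hu).
apply is_derive_unique.
assert (HEu : is_derive (fun s => E f (u s)) x (v' x * E f (u x) * (f (u x) * E f (u x)))).
{ apply (is_derive_comp (E f) u); [now apply E_derive|apply Hu]. }
eapply is_derive_eq.
- exact (is_derive_mult v' (fun s => E f (u s)) x _ _ Hl HEu Rmult_comm).
- unfold plus, mult; simpl. ring.
Qed.

(** * The nonlinear solution *)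

Lemma enorm_axis (r : R) : enorm (r, 0, 0) = Rabs r.
Proof.
unfold enorm. rewrite <- sqrt_Rsqr_abs. f_equal. unfold Rsqr. ring.
Qed.

Lemma enorm_swap2 (x y z : R) : enorm (x, y, z) = enorm (y, x, z).
Proof. unfold enorm. f_equal. ring. Qed.

Lemma enorm_swap3 (x y z : R) : enorm (x, y, z) = enorm (z, y, x).
Proof. unfold enorm. f_equal. ring. Qed.

Lemma mean_abs k g t r : Cinf g -> mean k g t (Rabs r) = mean k g t r.
Proof.
intros Hg. unfold Rabs. destruct (Rcase_abs r); [|reflexivity]. now apply mean_even.
Qed.

Lemma mean_enorm_dx k g (t x y z : R) : Cinf g ->
  is_derive (fun s => mean k g t (enorm (s, y, z))) x
    (x * (/ (2 * INR (S k)) * mean (S k) (Derive (Derive g)) t (enorm (x, y, z)))).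
Proof.
intros Hg.
pose proof (mean_enorm_line k g t 0 x y z 1 0 0 Hg) as H.
apply (is_derive_ext (fun s => mean k g (t + (s - x) * 0)
  (enorm (x + (s - x) * 1, y + (s - x) * 0, z + (s - x) * 0)))).
{ intros s. f_equal; [ring|]. unfold enorm. f_equal. ring. }
eapply is_derive_eq.
- apply (is_derive_comp (fun h => mean k g (t + h * 0) (enorm (x + h * 1, y + h * 0, z + h * 0)))
    (fun s => s - x)).
  + replace (x - x) with 0 by ring. exact H.
  + instantiate (1 := 1). auto_derive; [easy|ring].
- unfold scal; simpl. unfold mult; simpl. ring.
Qed.

Section Solution.

Variables (f g : R -> R) (u : R -> R3 -> R).
Hypotheses (Hf : Cinf f) (Hg : Cinf g).
Hypothesis Hu : forall t p, F f (u t p) = / 2 * mean 0 g t (enorm p).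

Lemma solution_smooth : smooth (fun q : R4 => u (fst q) (snd q)).
Proof.
intros n. apply (inverse_Ck f n _ (fun q : R4 => / 2 * wave 0 g q) Hf).
- intros q. apply Hu.
- apply Ck_mult; [apply Ck_const|now apply wave_Ck].
Qed.

Lemma solution_dt t p :
  is_derive (fun s => u s p) t (/ 2 * mean 0 (Derive g) t (enorm p) * E f (u t p)).
Proof.
apply (inverse_is_derive f (fun s => u s p) (fun s => / 2 * mean 0 g s (enorm p))); trivial.
apply (is_derive_scal (fun s => mean 0 g s (enorm p))). now apply mean_dt.
Qed.

Lemma solution_dtt t p : Derive_n (fun s => u s p) 2 t
  = E f (u t p) * (/ 2 * mean 0 (Derive (Derive g)) t (enorm p)) + f (u t p) * dt u t p ^ 2.
Proof.
apply (inverse_Derive2 f (fun s => u s p) (fun s => / 2 * mean 0 g s (enorm p))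
  (fun s => / 2 * mean 0 (Derive g) s (enorm p))); trivial.
- intros s. apply (is_derive_scal (fun s => mean 0 g s (enorm p))). now apply mean_dt.
- apply (is_derive_scal (fun s => mean 0 (Derive g) s (enorm p))). now apply mean_dt, Cinf_Derive.
Qed.

(** Stated for a function on the first axis: the other axes follow by permuting
    the coordinates inside the norm. *)
Lemma coordinate_dxx (w : R -> R) (t x y z : R) :
  (forall s, F f (w s) = / 2 * mean 0 g t (enorm (s, y, z))) ->
  Derive_n w 2 x
  = E f (w x) * (/ 4 * mean 1 (Derive (Derive g)) t (enorm (x, y, z))
      + x ^ 2 / 16 * mean 2 (Derive (Derive (Derive (Derive g)))) t (enorm (x, y, z)))
    + f (w x) * Derive w x ^ 2.
Proof.
intros Hw. set (g2 := Derive (Derive g)). set (g4 := Derive (Derive g2)).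
assert (Hg2 : Cinf g2) by now apply Cinf_Derive, Cinf_Derive.
apply (inverse_Derive2 f w (fun s => / 2 * mean 0 g t (enorm (s, y, z)))
  (fun s => / 2 * (s * (/ (2 * INR 1) * mean 1 g2 t (enorm (s, y, z)))))); trivial.
- intros s. apply (is_derive_scal (fun s => mean 0 g t (enorm (s, y, z)))). now apply mean_enorm_dx.
- eapply is_derive_eq.
  + apply (is_derive_scal (fun s => s * (/ (2 * INR 1) * mean 1 g2 t (enorm (s, y, z))))).
    apply (is_derive_mult (fun s => s) (fun s => / (2 * INR 1) * mean 1 g2 t (enorm (s, y, z)))).
    * apply (is_derive_id (K := R_AbsRing)).
    * apply (is_derive_scal (fun s => mean 1 g2 t (enorm (s, y, z)))).
      now apply mean_enorm_dx.
    * intros; apply Rmult_comm.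
  + fold g4. unfold plus, mult, one; simpl. field.
Qed.

Lemma solution_equation t p :
  Derive_n (fun s => u s p) 2 t - laplacian (u t) p
  = f (u t p) * (dt u t p ^ 2 - grad_sq (u t) p).
Proof.
rewrite solution_dtt. destruct p as [[x y] z].
unfold laplacian, grad_sq.
rewrite (coordinate_dxx (fun s => u t (s, y, z)) t x y z) by (intros; apply Hu).
rewrite (coordinate_dxx (fun s => u t (x, s, z)) t y x z).
2: { intros s. now rewrite Hu, enorm_swap2. }
rewrite (coordinate_dxx (fun s => u t (x, y, s)) t z y x).
2: { intros s. now rewrite Hu, enorm_swap3. }
rewrite (enorm_swap2 y x z), (enorm_swap3 z y x).
rewrite (mean_wave_equation (Derive (Derive g))) by now apply Cinf_Derive, Cinf_Derive.
(* The same expressions occur with syntactically different pair types. *)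
pose proof (enorm_sqr (x, y, z)) as HN. simpl dot in HN.
set (N := enorm (x, y, z)) in HN. pose (w := u t (x, y, z)). pose (ut := dt u t (x, y, z)).
pose (ux := Derive (fun s : R => u t (s, y, z)) x).
pose (uy := Derive (fun s : R => u t (x, s, z)) y).
pose (uz := Derive (fun s : R => u t (x, y, s)) z).
repeat match goal with
| |- context [enorm ?q] => change (enorm q) with N
| |- context [dt u t ?q] => change (dt u t q) with ut
| |- context [Derive ?h ?c] => first [change (Derive h c) with ux | change (Derive h c) with uy | change (Derive h c) with uz]
| |- context [u t (x, y, z)] => change (u t (x, y, z)) with w
end.
replace (N ^ 2) with (x ^ 2 + y ^ 2 + z ^ 2) by (simpl; simpl in HN; lra).
field.
Qed.

(** The two null derivatives of r v are the values of g at the ends of the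
    interval, here expressed through u. *)
Lemma solution_riemann t r :
  r * dr (u t) r = E f (profile (u t) r) * ((g (t + r) + g (t - r)) / 2 - F f (profile (u t) r)) /\
  r * profile (dt u t) r = E f (profile (u t) r) * ((g (t + r) - g (t - r)) / 2).
Proof.
assert (HF : forall s, F f (profile (u t) s) = / 2 * mean 0 g t s).
{ intros s. unfold profile. rewrite Hu, enorm_axis. now rewrite mean_abs. }
pose proof (mean_dr 0 g t r Hg) as Hd.
set (d := r / (2 * INR 1) * mean 1 (Derive (Derive g)) t r) in Hd.
pose proof (mean_dr_endpoints g t r d Hg Hd) as H1.
pose proof (mean_dt_endpoints g t r Hg) as H2.
split.
- unfold dr. rewrite (is_derive_unique _ r (/ 2 * d * E f (profile (u t) r))).
  + rewrite HF, <- H1. field.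
  + apply (inverse_is_derive f (profile (u t)) (fun s => / 2 * mean 0 g t s)); trivial.
    now apply (is_derive_scal (fun s => mean 0 g t s)).
- assert (Hdt : profile (dt u t) r
    = / 2 * mean 0 (Derive g) t (enorm (r, 0, 0)) * E f (profile (u t) r))
    by exact (is_derive_unique _ _ _ (solution_dt t (r, 0, 0))).
  rewrite Hdt, <- H2, enorm_axis, mean_abs by now apply Cinf_Derive. field.
Qed.

Lemma solution_center s : F f (u s (0, 0, 0)) = g s.
Proof. rewrite Hu, enorm_axis, Rabs_R0, mean_radius_0. field. Qed.

Lemma solution_attained t p : exists s, F f (u t p) = g s.
Proof.
destruct (mean_attained g t (enorm p) Hg) as [s Hs]. exists s. rewrite Hu, Hs. field.
Qed.

End Solution.

(** * Pointwise estimates *)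

Section Pointwise.

Variables f : R -> R.
Hypothesis Hf : Cinf f.

(** The values gp and gm of g are carried by the two characteristics through a
    point at radius r, where u has the value w and the derivatives ur and ut: with
    v = F(u) they are v + r v_r + r v_t and v + r v_r - r v_t. *)
Definition characteristic (r w ur ut gp gm : R) : Prop :=
  r * ur = E f w * ((gp + gm) / 2 - F f w) /\ r * ut = E f w * ((gp - gm) / 2).

(** The absolute value selects the smaller, respectively the larger, of the two
    characteristic values. *)
Lemma characteristic_slopes r w ur ut gp gm : 0 < r -> characteristic r w ur ut gp gm ->
  - ur + Rabs ut = E f w * (F f w - Rmin gp gm) / r /\
  ur + Rabs ut = E f w * (Rmax gp gm - F f w) / r.
Proof.
intros Hr [H1 H2]. pose proof (E_pos f w) as HE.
assert (H3 : r * Rabs ut = E f w * (Rmax gp gm - Rmin gp gm) / 2).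
{ rewrite <- (Rabs_pos_eq r) at 1 by lra. rewrite <- Rabs_mult, H2, Rabs_mult.
  rewrite (Rabs_pos_eq (E f w)) by lra.
  unfold Rmax, Rmin. destruct (Rle_dec gp gm).
  - rewrite Rabs_left1 by lra. field.
  - rewrite Rabs_pos_eq by lra. field. }
assert (H4 : Rmax gp gm + Rmin gp gm = gp + gm).
{ unfold Rmax, Rmin. destruct (Rle_dec gp gm); lra. }
split; apply (Rmult_eq_reg_l r); try lra;
  [replace (r * (E f w * (F f w - Rmin gp gm) / r)) with (E f w * (F f w - Rmin gp gm)) by (field; lra)
  |replace (r * (E f w * (Rmax gp gm - F f w) / r)) with (E f w * (Rmax gp gm - F f w)) by (field; lra)];
  rewrite Rmult_plus_distr_l, H3.
- replace (r * - ur) with (- (r * ur)) by ring. rewrite H1.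
  replace gp with (Rmax gp gm + Rmin gp gm - gm) at 1 by lra. field.
- rewrite H1. replace gp with (Rmax gp gm + Rmin gp gm - gm) at 1 by lra. field.
Qed.

Lemma Rdiv_lt_iff a b r : 0 < r -> (a / r < b / r <-> a < b).
Proof.
intros Hr. assert (0 < / r) by now apply Rinv_0_lt_compat. unfold Rdiv. split; intros H'; nra.
Qed.

Lemma Rdiv_le_iff a b r : 0 < r -> (a / r <= b / r <-> a <= b).
Proof.
intros Hr. assert (0 < / r) by now apply Rinv_0_lt_compat. unfold Rdiv. split; intros H'; nra.
Qed.

Lemma lower_strict r w ur ut gp gm (a : R) : 0 < r -> characteristic r w ur ut gp gm ->
  (- ur + Rabs ut < (F f w - a) * E f w / r <-> a < gp /\ a < gm).
Proof.
intros Hr HC. rewrite (proj1 (characteristic_slopes _ _ _ _ _ _ Hr HC)), Rdiv_lt_iff by trivial.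
pose proof (E_pos f w). unfold Rmin. destruct (Rle_dec gp gm); split; intros; [split| |split|]; nra.
Qed.

Lemma upper_strict r w ur ut gp gm (b : R) : 0 < r -> characteristic r w ur ut gp gm ->
  (ur + Rabs ut < (b - F f w) * E f w / r <-> gp < b /\ gm < b).
Proof.
intros Hr HC. rewrite (proj2 (characteristic_slopes _ _ _ _ _ _ Hr HC)), Rdiv_lt_iff by trivial.
pose proof (E_pos f w). unfold Rmax. destruct (Rle_dec gp gm); split; intros; [split| |split|]; nra.
Qed.

Lemma lower_quantitative r w ur ut gp gm (a : R) eps : 0 < r -> characteristic r w ur ut gp gm ->
  (- ur + Rabs ut <= ((F f w - a) * E f w - eps) / r
   <-> eps <= E f w * (gp - a) /\ eps <= E f w * (gm - a)).
Proof.
intros Hr HC. rewrite (proj1 (characteristic_slopes _ _ _ _ _ _ Hr HC)), Rdiv_le_iff by trivial.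
pose proof (E_pos f w). unfold Rmin. destruct (Rle_dec gp gm); split; intros; [split| |split|]; nra.
Qed.

Lemma upper_quantitative r w ur ut gp gm (b : R) eps : 0 < r -> characteristic r w ur ut gp gm ->
  (ur + Rabs ut <= ((b - F f w) * E f w - eps) / r
   <-> eps <= E f w * (b - gp) /\ eps <= E f w * (b - gm)).
Proof.
intros Hr HC. rewrite (proj2 (characteristic_slopes _ _ _ _ _ _ Hr HC)), Rdiv_le_iff by trivial.
pose proof (E_pos f w). unfold Rmax. destruct (Rle_dec gp gm); split; intros; [split| |split|]; nra.
Qed.

Lemma E_bounds B : exists c C, 0 < c /\ 0 < C /\ forall w, - B <= w <= B -> c <= E f w <= C.
Proof.
destruct (bounded_on_segment (RInt f 0) B) as [K [_ HK]].
{ intros. now apply Cinf_continuous, RInt_Cinf. }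
exists (exp (- K)), (exp K). split; [apply exp_pos|]. split; [apply exp_pos|].
intros w Hw. specialize (HK w Hw). apply Rabs_le_between in HK.
assert (Hle : forall x y, x <= y -> exp x <= exp y).
{ intros x y [H|<-]; [left; now apply exp_increasing|lra]. }
split; apply Hle; lra.
Qed.

(** Characteristic values in a compact part of the range of [F] bound the
    scaled derivatives, and keep a uniform distance from the limits of [F]. *)
Lemma compact_characteristics B : exists K eps, 0 < eps /\
  forall r w ur ut gp gm, 0 < r -> characteristic r w ur ut gp gm ->
  - B <= w <= B -> F f (- B) <= gp <= F f B -> F f (- B) <= gm <= F f B ->
  Rabs (r * ur) <= K /\ Rabs (r * ut) <= K /\
  ((exists a : R, is_lim (F f) m_infty a) -> - ur + Rabs ut <= (lower_int f w - eps) / r) /\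
  ((exists b : R, is_lim (F f) p_infty b) -> ur + Rabs ut <= (upper_int f w - eps) / r).
Proof.
destruct (E_bounds B) as [c [C [Hc [HC HE]]]].
(* A limit of F lies beyond the value of F one step further out; this gives a
   distance to it that makes sense whether or not the limit is finite. *)
set (d := Rmin (F f (- B) - F f (- B - 1)) (F f (B + 1) - F f B)).
assert (Hd : 0 < d).
{ assert (F f (- B - 1) < F f (- B)) by (apply F_lt; trivial; lra).
  assert (F f B < F f (B + 1)) by (apply F_lt; trivial; lra).
  apply Rmin_pos; lra. }
assert (Hd1 : d <= F f (- B) - F f (- B - 1)) by apply Rmin_l.
assert (Hd2 : d <= F f (B + 1) - F f B) by apply Rmin_r.
exists (C * (F f B - F f (- B))), (c * d). split; [nra|].
intros r w ur ut gp gm Hr Hch Hw Hgp Hgm. destruct (HE w Hw) as [HE1 HE2].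
pose proof Hch as [H1 H2].
assert (HFw : F f (- B) <= F f w <= F f B) by (split; apply F_le; trivial; lra).
set (D := F f B - F f (- B)). assert (HD : 0 <= D) by (unfold D; lra).
repeat split.
- rewrite H1, Rabs_mult, (Rabs_pos_eq (E f w)) by lra.
  apply Rmult_le_compat; try lra; [apply Rabs_pos|]. apply Rabs_le. unfold D. lra.
- rewrite H2, Rabs_mult, (Rabs_pos_eq (E f w)) by lra.
  apply Rmult_le_compat; try lra; [apply Rabs_pos|]. apply Rabs_le. unfold D. lra.
- intros [a Ha]. rewrite (lower_int_eq f a w Hf Ha).
  apply (lower_quantitative r w ur ut gp gm a _ Hr Hch).
  pose proof (F_lower_limit f a (- B - 1) Hf Ha).
  split; apply Rmult_le_compat; lra.
- intros [b Hb]. rewrite (upper_int_eq f b w Hf Hb).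
  apply (upper_quantitative r w ur ut gp gm b _ Hr Hch).
  pose proof (F_upper_limit f b (B + 1) Hf Hb).
  split; apply Rmult_le_compat; lra.
Qed.

(** Conversely, such bounds confine the characteristic values to a compact part
    of the range; when [F] has no finite limit on one side, it is the bound on
    the scaled derivatives that does so. *)
Lemma characteristics_compact B K eps : 0 < eps -> exists w1 w2,
  forall r w ur ut gp gm, 0 < r -> characteristic r w ur ut gp gm ->
  - B <= w <= B -> Rabs (r * ur) <= K -> Rabs (r * ut) <= K ->
  ((exists a : R, is_lim (F f) m_infty a) -> - ur + Rabs ut <= (lower_int f w - eps) / r) ->
  ((exists b : R, is_lim (F f) p_infty b) -> ur + Rabs ut <= (upper_int f w - eps) / r) ->
  (F f w1 <= gp <= F f w2) /\ (F f w1 <= gm <= F f w2).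
Proof.
intros Heps. destruct (E_bounds B) as [c [C [Hc [HC HE]]]].
assert (Hq : 0 < eps / C) by now apply Rdiv_lt_0_compat.
assert (Hlow : exists w1, forall y, F f (- B) - 2 * K / c <= y ->
  (forall a : R, is_lim (F f) m_infty a -> a + eps / C <= y) -> F f w1 <= y).
{ destruct (classic (exists a : R, is_lim (F f) m_infty a)) as [[a Ha]|Hn].
  - destruct (increasing_below (F f) (a + eps / C)) as [w1 Hw1].
    + intros; now apply F_le.
    + intros a' Ha'. apply is_lim_unique in Ha, Ha'. rewrite Ha in Ha'.
      injection Ha' as <-. lra.
    + exists w1. intros y _ Hy. specialize (Hy a Ha). lra.
  - destruct (increasing_below (F f) (F f (- B) - 2 * K / c)) as [w1 Hw1].
    + intros; now apply F_le.
    + intros a Ha. destruct Hn. now exists a.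
    + exists w1. intros y Hy _. lra. }
assert (Hup : exists w2, forall y, y <= F f B + 2 * K / c ->
  (forall b : R, is_lim (F f) p_infty b -> y + eps / C <= b) -> y <= F f w2).
{ destruct (classic (exists b : R, is_lim (F f) p_infty b)) as [[b Hb]|Hn].
  - destruct (increasing_above (F f) (b - eps / C)) as [w2 Hw2].
    + intros; now apply F_le.
    + intros b' Hb'. apply is_lim_unique in Hb, Hb'. rewrite Hb in Hb'.
      injection Hb' as <-. lra.
    + exists w2. intros y _ Hy. specialize (Hy b Hb). lra.
  - destruct (increasing_above (F f) (F f B + 2 * K / c)) as [w2 Hw2].
    + intros; now apply F_le.
    + intros b Hb. destruct Hn. now exists b.
    + exists w2. intros y Hy _. lra. }
destruct Hlow as [w1 Hlow], Hup as [w2 Hup]. exists w1, w2.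
intros r w ur ut gp gm Hr Hch Hw Hur Hut Ha Hb. destruct (HE w Hw) as [HE1 HE2].
assert (HFw : F f (- B) <= F f w <= F f B) by (split; apply F_le; trivial; lra).
pose proof Hch as [H1 H2].
apply Rabs_le_between in Hur, Hut.
assert (HEi : / E f w <= / c) by now apply Rinv_le_contravar.
assert (HEp : 0 < / E f w) by (apply Rinv_0_lt_compat; lra).
assert (HK : 0 <= K) by lra.
assert (HKE : 2 * K / E f w <= 2 * K / c) by (unfold Rdiv; apply Rmult_le_compat_l; lra).
assert (Hgp : gp = F f w + (r * ur + r * ut) / E f w).
{ rewrite H1, H2. field. lra. }
assert (Hgm : gm = F f w + (r * ur - r * ut) / E f w).
{ rewrite H1, H2. field. lra. }
assert (Hbd : forall X, - (2 * K) <= X <= 2 * K -> - (2 * K / c) <= X / E f w <= 2 * K / c).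
{ intros X HX. unfold Rdiv in *. split; nra. }
assert (Hbp := Hbd (r * ur + r * ut) ltac:(lra)).
assert (Hbm := Hbd (r * ur - r * ut) ltac:(lra)).
assert (Hdiv : forall y, eps <= E f w * y -> eps / C <= y).
{ intros y Hy. assert (0 < y) by nra. apply (Rmult_le_reg_l C); trivial.
  replace (C * (eps / C)) with eps by (field; lra). nra. }
assert (Ha' : forall a : R, is_lim (F f) m_infty a -> a + eps / C <= gp /\ a + eps / C <= gm).
{ intros a Hla. specialize (Ha (ex_intro _ a Hla)). rewrite (lower_int_eq f a w Hf Hla) in Ha.
  apply (lower_quantitative r w ur ut gp gm a _ Hr Hch) in Ha. destruct Ha as [Hp Hm].
  apply Hdiv in Hp, Hm. lra. }
assert (Hb' : forall b : R, is_lim (F f) p_infty b -> gp + eps / C <= b /\ gm + eps / C <= b).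
{ intros b Hlb. specialize (Hb (ex_intro _ b Hlb)). rewrite (upper_int_eq f b w Hf Hlb) in Hb.
  apply (upper_quantitative r w ur ut gp gm b _ Hr Hch) in Hb. destruct Hb as [Hp Hm].
  apply Hdiv in Hp, Hm. lra. }
repeat split; (apply Hlow || apply Hup); try lra; intros l Hl; now apply Ha' || now apply Hb'.
Qed.

End Pointwise.

(** * The Cauchy problem *)

Lemma profile_Cinf h : smooth h -> Cinf (profile h).
Proof.
intros Hh n x.
apply (ex_derive_n_ext (fun s : R => h (plus ((0, 0, 0) : R3) (scal s ((1, 0, 0) : R3))))).
- intros s. apply (f_equal h).
  change ((0 + s * 1, 0 + s * 0, 0 + s * 0) = (s, 0, 0) :> R * R * R).
  repeat apply (f_equal2 pair); ring.
- now apply (smooth_line (V := R3)).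
Qed.

Lemma profile_even h r : radial h -> profile h (- r) = profile h r.
Proof. intros Hh. apply Hh. now rewrite !enorm_axis, Rabs_Ropp. Qed.

Lemma profile_enorm h p : radial h -> profile h (enorm p) = h p.
Proof. intros Hh. apply Hh. rewrite enorm_axis. apply Rabs_pos_eq, enorm_pos. Qed.

Section Cauchy.

Variables (f : R -> R) (u0 u1 : R3 -> R).
Hypotheses (Hf : Cinf f) (Hu0 : smooth u0) (Hu1 : smooth u1)
  (Ru0 : radial u0) (Ru1 : radial u1).

(** The initial data of the linear equation, F(u0) and F'(u0) u1, as even
    functions on the whole line. *)
Definition v0 (r : R) : R := F f (profile u0 r).
Definition v1 (r : R) : R := exp (- RInt f 0 (profile u0 r)) * profile u1 r.

Lemma v0_Cinf : Cinf v0.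
Proof. apply (Cinf_comp (F f) (profile u0)); [now apply F_Cinf|now apply profile_Cinf]. Qed.

Lemma v1_Cinf : Cinf v1.
Proof.
apply Cinf_mult; [|now apply profile_Cinf].
apply (Cinf_comp (fun s => exp (- RInt f 0 s)) (profile u0)).
- now apply F_integrand_Cinf.
- now apply profile_Cinf.
Qed.

Lemma v0_even r : v0 (- r) = v0 r.
Proof. unfold v0. now rewrite profile_even. Qed.

Lemma v1_even r : v1 (- r) = v1 r.
Proof. unfold v1. now rewrite !profile_even. Qed.

Definition data : R -> R := transport v0 v1.

Lemma data_Cinf : Cinf data.
Proof. apply transport_Cinf; [apply v0_Cinf|apply v1_Cinf]. Qed.

Lemma data_0 : data 0 = F f (u0 (0, 0, 0)).
Proof. unfold data, transport, v0, profile. ring. Qed.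

(** As v0 and v1 are even, g(- r) is v0(r) + r v0'(r) - r v1(r), the value
    carried by the other characteristic. *)
Lemma data_characteristic r :
  characteristic f r (profile u0 r) (dr u0 r) (profile u1 r) (data r) (data (- r)).
Proof.
pose proof (E_pos f (profile u0 r)) as HE.
unfold data, transport.
rewrite (Derive_even v0 r v0_Cinf v0_even), v0_even, v1_even.
assert (Hd : Derive v0 r = dr u0 r * / E f (profile u0 r)).
{ apply is_derive_unique. apply (is_derive_comp (F f) (profile u0)).
  - now apply F_derive.
  - now apply Cinf_is_derive, profile_Cinf. }
unfold v1. rewrite E_opp, Hd. fold (v0 r). unfold characteristic. fold (v0 r).
split; field; lra.
Qed.

Lemma data_everywhere (P : R -> Prop) : P (data 0) ->
  (forall r, 0 < r -> P (data r) /\ P (data (- r))) -> forall s, P (data s).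
Proof.
intros H0 H s. destruct (Rtotal_order s 0) as [Hs|[->|Hs]]; trivial.
- rewrite <- (Ropp_involutive s). apply H. lra.
- now apply H.
Qed.

(** The averages of g are values of g, so they lie in the range of F and F can be
    inverted on them. *)
Lemma Cauchy_solution : (forall s, exists w, F f w = data s) ->
  exists u : R -> R3 -> R, smooth_solution f u0 u1 u /\ (forall t, radial (u t)) /\
    (forall t r, characteristic f r (profile (u t) r) (dr (u t) r) (profile (dt u t) r)
       (data (t + r)) (data (t - r))) /\
    (forall s, F f (u s (0, 0, 0)) = data s) /\
    (forall t p, exists s, F f (u t p) = data s).
Proof.
intros Hrange. pose proof data_Cinf as Hg.
destruct (functional_choice (fun (q : R * R) w => F f w = / 2 * mean 0 data (fst q) (snd q)))
  as [U HU].
{ intros [t r]. destruct (mean_attained data t r Hg) as [s Hs].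
  destruct (Hrange s) as [w Hw]. exists w. simpl. rewrite Hw, Hs. field. }
set (u := fun (t : R) (p : R3) => U (t, enorm p)).
assert (Hu : forall t p, F f (u t p) = / 2 * mean 0 data t (enorm p)).
{ intros t p. apply HU. }
assert (Hi : forall p, u 0 p = u0 p).
{ intros p. apply (F_inj f); trivial. rewrite Hu. unfold data.
  rewrite transport_mean by (apply v0_Cinf || apply v1_Cinf || apply v0_even || apply v1_even).
  unfold v0. rewrite profile_enorm by trivial. field. }
exists u. split; [|split; [|split; [|split]]].
- split; [|split; [|split]].
  + now apply (solution_smooth f data u).
  + now apply (solution_equation f data u).
  + exact Hi.
  + intros p.
    transitivity (/ 2 * mean 0 (Derive data) 0 (enorm p) * E f (u 0 p)).
    { exact (is_derive_unique _ _ _ (solution_dt f data u Hf Hg Hu 0 p)). }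
    rewrite Hi. unfold data.
    rewrite transport_dt_mean by (apply v0_Cinf || apply v1_Cinf || apply v0_even || apply v1_even).
    unfold v1. rewrite E_opp, !profile_enorm by trivial.
    pose proof (E_pos f (u0 p)). field. lra.
- intros t p q Hpq. unfold u. now rewrite Hpq.
- intros t r. now apply solution_riemann.
- now apply solution_center.
- now apply solution_attained.
Qed.

Section Boundedness.

Variable u : R -> R3 -> R.
Hypothesis Hchar : forall t r,
  characteristic f r (profile (u t) r) (dr (u t) r) (profile (dt u t) r)
    (data (t + r)) (data (t - r)).
Hypothesis Hcenter : forall s, F f (u s (0, 0, 0)) = data s.
Hypothesis Hattained : forall t p, exists s, F f (u t p) = data s.

Lemma bounded_solution_of_data B w1 w2 :
  (forall p, Rabs (u0 p) <= B) ->
  (forall r, 0 < r -> (F f w1 <= data r <= F f w2) /\ (F f w1 <= data (- r) <= F f w2)) ->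
  bounded_tx u.
Proof.
intros HB Hw. set (M := Rabs w1 + Rabs w2 + B).
assert (H1 : forall s, F f (- M) <= data s <= F f M).
{ pose proof (Rabs_pos (u0 (0, 0, 0))). specialize (HB (0, 0, 0)).
  assert (Hle : F f (- M) <= F f w1 /\ F f w2 <= F f M).
  { pose proof (Rabs_pos w1); pose proof (Rabs_pos w2).
    pose proof (proj1 (Rabs_le_between w1 (Rabs w1)) (Rle_refl _)).
    pose proof (proj1 (Rabs_le_between w2 (Rabs w2)) (Rle_refl _)).
    split; apply F_le; trivial; unfold M; lra. }
  apply (data_everywhere (fun y => F f (- M) <= y <= F f M)).
  - rewrite data_0. apply Rabs_le_between in HB.
    pose proof (Rabs_pos w1); pose proof (Rabs_pos w2).
    split; apply F_le; trivial; unfold M; lra.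
  - intros r Hr. specialize (Hw r Hr). lra. }
exists M. intros t p. destruct (Hattained t p) as [s Hs]. specialize (H1 s).
rewrite <- Hs in H1. apply Rabs_le. split; apply (F_le_inv f); trivial; apply H1.
Qed.

Lemma data_of_bounded_solution B : (forall t p, Rabs (u t p) <= B) ->
  forall s, F f (- B) <= data s <= F f B.
Proof.
intros HB s. rewrite <- Hcenter. specialize (HB s (0, 0, 0)).
apply Rabs_le_between in HB. split; apply F_le; trivial; apply HB.
Qed.

End Boundedness.

End Cauchy.

Theorem proposition1p4 (f : R -> R) (u0 u1 : R3 -> R)
  (hf : forall n x, ex_derive_n f n x)
  (hu0 : smooth u0) (hu1 : smooth u1)
  (ru0 : radial u0) (ru1 : radial u1) :
  (* the equalities displayed in (A) and (B), with convergence of the integrals *)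
  (forall a : R, is_lim (F f) m_infty a -> forall w,
     is_RInt_gen (fun s => exp (RInt f s w)) (Rbar_locally m_infty) (at_point w)
       ((F f w - a) / Derive (F f) w))
  /\
  (forall b : R, is_lim (F f) p_infty b -> forall w,
     is_RInt_gen (fun s => exp (RInt f s w)) (at_point w) (Rbar_locally p_infty)
       ((b - F f w) / Derive (F f) w))
  /\
  (* (1) *)
  (is_lim (F f) p_infty p_infty -> is_lim (F f) m_infty m_infty ->
   exists u : R -> R3 -> R,
     smooth_solution f u0 u1 u /\ (forall t, radial (u t)) /\
     (bounded_x u0 ->
        ((bounded_r (fun r => r * dr u0 r) /\ bounded_r (fun r => r * profile u1 r))
           <-> bounded_tx u) /\
        (bounded_tx u ->
           bounded_tr (fun t r => r * dr (u t) r) /\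
           bounded_tr (fun t r => r * profile (dt u t) r))))
  /\
  (* (2) and (3) *)
  ((forall a : R, is_lim (F f) m_infty a -> forall r, 0 < r ->
      - dr u0 r + Rabs (profile u1 r)
        < (F f (profile u0 r) - a) / (r * Derive (F f) (profile u0 r))) ->
   (forall b : R, is_lim (F f) p_infty b -> forall r, 0 < r ->
      dr u0 r + Rabs (profile u1 r)
        < (b - F f (profile u0 r)) / (r * Derive (F f) (profile u0 r))) ->
   exists u : R -> R3 -> R,
     smooth_solution f u0 u1 u /\ (forall t, radial (u t)) /\
     ((exists a : R, is_lim (F f) m_infty a) -> forall t r, 0 < r ->
        - dr (u t) r + Rabs (profile (dt u t) r)
          < lower_int f (profile (u t) r) / r) /\
     ((exists b : R, is_lim (F f) p_infty b) -> forall t r, 0 < r ->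
        dr (u t) r + Rabs (profile (dt u t) r)
          < upper_int f (profile (u t) r) / r) /\
     (bounded_x u0 ->
        ((bounded_r (fun r => r * dr u0 r) /\ bounded_r (fun r => r * profile u1 r) /\
          exists eps, 0 < eps /\
            ((exists a : R, is_lim (F f) m_infty a) -> forall r, 0 < r ->
               - dr u0 r + Rabs (profile u1 r)
                 <= (lower_int f (profile u0 r) - eps) / r) /\
            ((exists b : R, is_lim (F f) p_infty b) -> forall r, 0 < r ->
               dr u0 r + Rabs (profile u1 r)
                 <= (upper_int f (profile u0 r) - eps) / r))
           <-> bounded_tx u) /\
        (bounded_tx u ->
           bounded_tr (fun t r => r * dr (u t) r) /\
           bounded_tr (fun t r => r * profile (dt u t) r) /\
           exists eps', 0 < eps' /\
             ((exists a : R, is_lim (F f) m_infty a) -> forall t r, 0 < r ->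
                - dr (u t) r + Rabs (profile (dt u t) r)
                  <= (lower_int f (profile (u t) r) - eps') / r) /\
             ((exists b : R, is_lim (F f) p_infty b) -> forall t r, 0 < r ->
                dr (u t) r + Rabs (profile (dt u t) r)
                  <= (upper_int f (profile (u t) r) - eps') / r)))).
Proof.
assert (Hlow : forall a r w : R, 0 < r ->
  (F f w - a) / (r * Derive (F f) w) = (F f w - a) * E f w / r).
{ intros a r w Hr. rewrite F_Derive by trivial. pose proof (E_pos f w). field. lra. }
assert (Hup : forall b r w : R, 0 < r ->
  (b - F f w) / (r * Derive (F f) w) = (b - F f w) * E f w / r).
{ intros b r w Hr. rewrite F_Derive by trivial. pose proof (E_pos f w). field. lra. }
split; [|split].
- intros a Ha w. replace ((F f w - a) / Derive (F f) w) with ((F f w - a) * E f w).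
  + now apply lower_is_RInt_gen.
  + rewrite F_Derive by trivial. pose proof (E_pos f w). field. lra.
- intros b Hb w. replace ((b - F f w) / Derive (F f) w) with ((b - F f w) * E f w).
  + now apply upper_is_RInt_gen.
  + rewrite F_Derive by trivial. pose proof (E_pos f w). field. lra.
(* When F has no finite limits, the hypotheses and the uniform inequalities of
   the last part are vacuous, and it contains the preceding one. *)
- assert (and_by : forall P Q : Prop, (Q -> P) -> Q -> P /\ Q) by tauto.
  apply and_by; clear and_by.
  + intros Hglobal Hp Hm.
    assert (Hna : ~ exists a : R, is_lim (F f) m_infty a).
    { intros [a Ha]. apply is_lim_unique in Ha, Hm. rewrite Ha in Hm. discriminate. }
    assert (Hnb : ~ exists b : R, is_lim (F f) p_infty b).
    { intros [b Hb]. apply is_lim_unique in Hb, Hp. rewrite Hb in Hp. discriminate. }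
    destruct Hglobal as [u [Hu [Hrad [_ [_ Hbd]]]]].
    { intros a Ha. destruct Hna. now exists a. }
    { intros b Hb. destruct Hnb. now exists b. }
    exists u. split; [exact Hu|]. split; [exact Hrad|].
    intros H0. destruct (Hbd H0) as [Hiff Hcons]. split.
    * rewrite <- Hiff. split.
      -- intros [H1 H2]. split; [exact H1|]. split; [exact H2|].
         exists 1. split; [lra|]. split; intros H; exfalso; auto.
      -- intros [H1 [H2 _]]. now split.
    * intros Hu'. destruct (Hcons Hu') as [H1 [H2 _]]. now split.
  + intros HA HB.
    assert (Hrange : forall s, exists w, F f w = data f u0 u1 s).
    { intros s. apply F_range; trivial.
      - intros a Ha. revert s. apply (data_everywhere f u0 u1 (fun y => a < y)).
        + rewrite data_0. now apply F_lower_limit.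
        + intros r Hr. specialize (HA a Ha r Hr). rewrite Hlow in HA by trivial.
          apply (lower_strict f r _ _ _ _ _ a Hr (data_characteristic f u0 u1 hf hu0 ru0 ru1 r)).
          exact HA.
      - intros b Hb. revert s. apply (data_everywhere f u0 u1 (fun y => y < b)).
        + rewrite data_0. now apply F_upper_limit.
        + intros r Hr. specialize (HB b Hb r Hr). rewrite Hup in HB by trivial.
          apply (upper_strict f r _ _ _ _ _ b Hr (data_characteristic f u0 u1 hf hu0 ru0 ru1 r)).
          exact HB. }
    destruct (Cauchy_solution f u0 u1 hf hu0 hu1 ru0 ru1 Hrange)
      as [u [Hu [Hrad [Hchar [Hcenter Hatt]]]]].
    exists u. split; [exact Hu|]. split; [exact Hrad|]. split; [|split].
    * intros [a Ha] t r Hr. rewrite (lower_int_eq f a _ hf Ha).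
      apply (lower_strict f r _ _ _ _ _ a Hr (Hchar t r)).
      rewrite <- !Hcenter. split; now apply F_lower_limit.
    * intros [b Hb] t r Hr. rewrite (upper_int_eq f b _ hf Hb).
      apply (upper_strict f r _ _ _ _ _ b Hr (Hchar t r)).
      rewrite <- !Hcenter. split; now apply F_upper_limit.
    * intros [B0 HB0].
      assert (Hcompact : forall B, (forall t p, Rabs (u t p) <= B) ->
        forall s, F f (- B) <= data f u0 u1 s <= F f B)
        by exact (data_of_bounded_solution f u0 u1 hf u Hcenter).
      split; [split|].
      -- intros [[M1 HM1] [[M2 HM2] [eps [Heps [Hl Hr]]]]].
         destruct (characteristics_compact f hf B0 (Rmax M1 M2) eps Heps) as [w1 [w2 Hw]].
         apply (bounded_solution_of_data f u0 u1 hf u Hatt B0 w1 w2 HB0).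
         intros r Hr0.
         apply (Hw r _ _ _ _ _ Hr0 (data_characteristic f u0 u1 hf hu0 ru0 ru1 r)).
         ++ apply Rabs_le_between, HB0.
         ++ eapply Rle_trans; [now apply HM1|apply Rmax_l].
         ++ eapply Rle_trans; [now apply HM2|apply Rmax_r].
         ++ intros Ha. now apply Hl.
         ++ intros Hb. now apply Hr.
      -- intros [B HB'].
         destruct (compact_characteristics f hf B) as [K [eps [Heps HK]]].
         assert (HB1 : forall p, - B <= u0 p <= B).
         { intros p. apply Rabs_le_between. rewrite <- (proj1 (proj2 (proj2 Hu)) p). apply HB'. }
         pose proof (fun r Hr => HK r _ _ _ _ _ Hr (data_characteristic f u0 u1 hf hu0 ru0 ru1 r)
           (HB1 _) (Hcompact B HB' _) (Hcompact B HB' _)) as H.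
         split; [exists K; intros r Hr; now apply H|].
         split; [exists K; intros r Hr; now apply H|].
         exists eps. split; [exact Heps|].
         split; intros Hl r Hr; now apply H.
      -- intros [B HB'].
         destruct (compact_characteristics f hf B) as [K [eps [Heps HK]]].
         pose proof (fun t r Hr => HK r _ _ _ _ _ Hr (Hchar t r)
           (proj1 (Rabs_le_between _ _) (HB' t _)) (Hcompact B HB' _) (Hcompact B HB' _)) as H.
         split; [exists K; intros t r Hr; now apply H|].
         split; [exists K; intros t r Hr; now apply H|].
         exists eps. split; [exact Heps|].
         split; intros Hl t r Hr; now apply H.
Qed.
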